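(* For every integer $k>2$ (not necessarily constant), there is a deterministic polynomial-time algorithm that, given an $n$-vertex digraph $G$, outputs a directed $k$-spanner of $G$ whose number of edges is at most $O((n\log n)^{1-1/k})$ times the minimum number of edges of a directed $k$-spanner of $G$.
   Context: Given a digraph $G=(V,E)$ and an integer $k\ge1$, a directed $k$-spanner of $G$ is a subgraph $H=(V,E_H)$ with $E_H\subseteq E$ such that $d_H(u,v)\le k\cdot d_G(u,v)$ for all $u,v\in V$ (distances are directed shortest-path lengths, $\infty$ if no path); equivalently, every edge $(u,v)\in E$ is joined by a directed path of length at most $k$ in $H$. The problem Directed $k$-Spanner asks for a directed $k$-spanner with the fewest edges. *)

(* Defs.v *)
From Stdlib Require Import Arith List Reals.
Import ListNotations.

(* Digraphs on the vertex set {0,...,n-1}: a boolean edge relation     *)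
(* E : nat -> nat -> bool, of which only the values on [0,n)^2 matter. *)

Fixpoint reach_le (n : nat) (H : nat -> nat -> bool) (m : nat) (u v : nat) : Prop :=
  match m with
  | O => u = v
  | S m' => u = v \/ exists w, w < n /\ H u w = true /\ reach_le n H m' w v
  end.

Definition is_spanner (n k : nat) (E H : nat -> nat -> bool) : Prop :=
  (forall i j, i < n -> j < n -> H i j = true -> E i j = true) /\
  (forall u v, u < n -> v < n -> E u v = true -> reach_le n H k u v).

Definition num_edges (n : nat) (E : nat -> nat -> bool) : nat :=
  length (filter (fun p => E (fst p) (snd p)) (list_prod (seq 0 n) (seq 0 n))).

(* Deterministic machine model: unit-cost RAM with addition, truncated *)
(* subtraction, indirect addressing and conditional jumps (polynomially *)
(* equivalent to Turing machines).                                     *)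

Inductive instr : Type :=
| IConst (r c : nat)
| IAdd (r a b : nat)
| ISub (r a b : nat)
| ILoad (r a : nat)
| IStore (a b : nat)
| IJz (a l : nat)
| IJmp (l : nat).

Definition program := list instr.

Definition upd (m : nat -> nat) (a v : nat) : nat -> nat :=
  fun x => if Nat.eqb x a then v else m x.

Fixpoint exec (P : program) (fuel pc : nat) (m : nat -> nat) : option (nat -> nat) :=
  match fuel with
  | O => None
  | S f =>
    match nth_error P pc with
    | None => Some m
    | Some i =>
      match i with
      | IConst r c => exec P f (S pc) (upd m r c)
      | IAdd r a b => exec P f (S pc) (upd m r (m a + m b))
      | ISub r a b => exec P f (S pc) (upd m r (m a - m b))
      | ILoad r a => exec P f (S pc) (upd m r (m (m a)))
      | IStore a b => exec P f (S pc) (upd m (m a) (m b))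
      | IJz a l => if Nat.eqb (m a) 0 then exec P f l m else exec P f (S pc) m
      | IJmp l => exec P f l m
      end
    end
  end.

(* Input encoding: M[0] = n, M[1] = k, M[2 + i*n + j] = [(i,j) in E]
   for i, j < n, all other cells 0. *)
Definition encode_input (n k : nat) (E : nat -> nat -> bool) : nat -> nat :=
  fun x =>
    if Nat.eqb x 0 then n
    else if Nat.eqb x 1 then k
    else if Nat.ltb x (2 + n * n) then
      (if E ((x - 2) / n) ((x - 2) mod n) then 1 else 0)
    else 0.

Definition decode_output (n : nat) (m : nat -> nat) : nat -> nat -> bool :=
  fun i j => negb (Nat.eqb (m (2 + i * n + j)) 0).

Definition ratio (n k : nat) : R :=
  Rpower (INR n * ln (INR n)) (1 - 1 / INR k).

(* Main.v *)
Require Import Defs.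
From Stdlib Require Import Arith ZArith List Lia Bool Reals Lra.
Import ListNotations.

(* Let [Delta = (n log n) ^ (1 / k)] and fix an optimal spanner [H]. At most [|H| / Delta] vertices
   have out-degree above [Delta] in [H], and the paths of length at most [k] of [H] avoiding these
   heavy vertices join at most [2 |H| Delta ^ (k - 1)] pairs. An edge [(u, v)] of the digraph whose
   path in [H] meets a heavy vertex [w] satisfies [d(u, w) + d(w, v) <= k], so it is spanned by a
   shortest-path in-tree and out-tree at [w], at a cost of at most [2 n] edges. Greedily choosing
   the vertex [w] spanning most of the remaining edges, as long as it spans at least [2 n] of them,
   and finally adding the remaining edges is a set cover heuristic: after about
   [2 (|H| / Delta) log n] choices only [O(|H| Delta ^ (k - 1))] edges remain, and later choices do
   not increase the total. The two costs balance at [(n log n) ^ (1 - 1 / k) |H|]. When [Delta < 2]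
   even keeping all non-loop edges is good enough.

   On the machine, the input leaves no free cell at a constant address except those holding [n]
   and [k]. The cells needed as registers contain bits, which are packed into one number before
   anything else; the algorithm itself is written in a language of total loop programs. *)

(** * A loop language and its compilation *)

(** The algorithm sees neither [H] nor Delta: both occur only in the analysis, so no real number is
    ever computed. A pair joined without heavy vertices is charged to the first edge of its path in
    [H], and the remaining [k - 1] steps branch at most Delta ways; this is why the bound carries
    the factor [|H|] and not [n]. Loops have no first edge: they are dropped at the outset, being
    spanned by the empty path.

    The threshold [2 n] is the price of two trees. A choice that reaches it removes at least as many
    edges as it adds, so edges kept plus edges remaining never grow; below it, the [h] heavy
    vertices together span at most [2 n h] remaining edges. As at most [n * n] edges exist, [n]
    rounds suffice, and rounds below the threshold simply do nothing.

    Since [k] need not be constant, no loop may run [k] times. Distances are stationary after [n]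
    relaxation rounds because shortest paths have distinct vertices, and [k] enters only through
    comparisons, with [k + 1] as infinity. *)

Definition steps (P : program) (t pc : nat) (m : nat -> nat) (pc' : nat) (m' : nat -> nat) : Prop :=
  forall f, exec P (t + f) pc m = exec P f pc' m'.

Lemma steps_refl P pc m : steps P 0 pc m pc m.
Proof. intros f; reflexivity. Qed.

(** Quantifying over the leftover fuel makes running times additive and lets a [steps] fact be used
    inside any longer run. *)
Lemma steps_trans P t1 t2 pc1 m1 pc2 m2 pc3 m3 :
  steps P t1 pc1 m1 pc2 m2 -> steps P t2 pc2 m2 pc3 m3 -> steps P (t1 + t2) pc1 m1 pc3 m3.
Proof. intros H1 H2 f. rewrite <- Nat.add_assoc, H1. apply H2. Qed.

Definition next (i : instr) (pc : nat) (m : nat -> nat) : nat * (nat -> nat) :=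
  match i with
  | IConst r c => (S pc, upd m r c)
  | IAdd r a b => (S pc, upd m r (m a + m b))
  | ISub r a b => (S pc, upd m r (m a - m b))
  | ILoad r a => (S pc, upd m r (m (m a)))
  | IStore a b => (S pc, upd m (m a) (m b))
  | IJz a l => (if Nat.eqb (m a) 0 then l else S pc, m)
  | IJmp l => (l, m)
  end.

Lemma steps_next P pc m i : nth_error P pc = Some i ->
  steps P 1 pc m (fst (next i pc m)) (snd (next i pc m)).
Proof.
  intros H f. cbn [exec Nat.add]. rewrite H. destruct i; cbn; try reflexivity.
  destruct (m a =? 0); reflexivity.
Qed.

Lemma steps_cons P pc m i t pc' m' : nth_error P pc = Some i ->
  steps P t (fst (next i pc m)) (snd (next i pc m)) pc' m' ->
  steps P (S t) pc m pc' m'.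
Proof. intros H H'. exact (steps_trans _ 1 _ _ _ _ _ _ _ (steps_next _ _ m _ H) H'). Qed.

Lemma upd_same m a v : upd m a v a = v.
Proof. unfold upd. now rewrite Nat.eqb_refl. Qed.

Lemma upd_other m a v x : x <> a -> upd m a v x = m x.
Proof. intros H. unfold upd. apply Nat.eqb_neq in H. now rewrite H. Qed.

Fixpoint code_at (P : program) (pc : nat) (c : list instr) : Prop :=
  match c with
  | [] => True
  | i :: c' => nth_error P pc = Some i /\ code_at P (S pc) c'
  end.

Lemma code_at_app P pc c1 c2 :
  code_at P pc (c1 ++ c2) <-> code_at P pc c1 /\ code_at P (pc + length c1) c2.
Proof.
  revert pc. induction c1 as [|i c1 IH]; intros pc; cbn.
  - rewrite Nat.add_0_r. tauto.
  - rewrite IH. rewrite Nat.add_succ_comm. tauto.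
Qed.

Lemma code_at_mid pre c post : code_at (pre ++ c ++ post) (length pre) c.
Proof.
  revert pre. induction c as [|i c IH]; intros pre; cbn; [trivial|split].
  - rewrite nth_error_app2 by lia. now rewrite Nat.sub_diag.
  - specialize (IH (pre ++ [i])). rewrite <- app_assoc in IH. cbn in IH.
    rewrite length_app in IH. cbn in IH. now rewrite Nat.add_1_r in IH.
Qed.

(** * Syntax and states of the loop language *)

Inductive expr : Type :=
| EN
| EK
| EC (c : nat)
| EV (x : nat)
| EAdd (e1 e2 : expr)
| ESub (e1 e2 : expr)
| EArr (a : nat) (e : expr).

(** Every loop makes exactly [n] passes, so programs are total and their running time is polynomial
    in [n] by their shape alone, whatever the data and [k]. *)
Inductive cmd : Type :=
| CSkip
| CSet (x : nat) (e : expr)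
| CPut (a : nat) (e1 e2 : expr)
| CRead (x : nat) (e : expr)
| CWrite (e1 e2 : expr)
| CSeq (c1 c2 : cmd)
| CIf (e : expr) (c1 c2 : cmd)
| CFor (x : nat) (c : cmd).

(** Scalar variables, unbounded arrays, and the raw cells in which input and output stay in
    place. *)
Record st : Type := St { vr : nat -> nat; ar : nat -> nat -> nat; rw : nat -> nat }.

Definition setv (s : st) (x v : nat) : st :=
  St (fun y => if Nat.eqb y x then v else vr s y) (ar s) (rw s).
Definition seta (s : st) (a i v : nat) : st :=
  St (vr s) (fun b => if Nat.eqb b a then upd (ar s a) i v else ar s b) (rw s).
Definition setw (s : st) (y v : nat) : st := St (vr s) (ar s) (upd (rw s) y v).

(** A binary numeral whose leading bit is the cell of smallest address, because packing doubles the
    accumulator before each new bit. *)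
Fixpoint bits_val (m : nat -> nat) (i r : nat) : nat :=
  match r with
  | 0 => 0
  | S r' => m i * 2 ^ r' + bits_val m (S i) r'
  end.

Lemma bits_val_lt m r : forall i, (forall j, i <= j -> m j <= 1) -> bits_val m i r < 2 ^ r.
Proof.
  induction r as [|r IH]; intros i Hm; cbn [bits_val].
  - cbn. lia.
  - assert (H1 := IH (S i) ltac:(intros j Hj; apply Hm; lia)). specialize (Hm i (le_n i)).
    rewrite Nat.pow_succ_r'. nia.
Qed.

Lemma bits_val_fold m r : forall i a,
  fold_left (fun a j => a + a + m j) (seq i r) a = a * 2 ^ r + bits_val m i r.
Proof.
  induction r as [|r IH]; intros i a; cbn [seq fold_left bits_val].
  - cbn. lia.
  - rewrite IH, Nat.pow_succ_r'. nia.
Qed.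

(** * Semantics and compilation *)

Section Machine.
(* [NR] registers, [NV] of them holding variables, and [Q] interleaved arrays *)
Variables (NR NV Q : nat).

Section Semantics.
Variables (n k : nat).

(** The input ends below [2 + n * n] and the registers below [NR]; this sum lies beyond both, so
    arrays stored from here on collide with neither. *)
Definition base : nat := NR + 2 + n * n.

Definition in_raw (y : nat) : bool := (NR <=? y) && (y <? base).

Fixpoint eval (e : expr) (s : st) : nat :=
  match e with
  | EN => n
  | EK => k
  | EC c => c
  | EV x => vr s x
  | EAdd e1 e2 => eval e1 s + eval e2 s
  | ESub e1 e2 => eval e1 s - eval e2 s
  | EArr a e => ar s a (eval e s)
  end.

Fixpoint run_cmd (c : cmd) (s : st) : st :=
  match c with
  | CSkip => s
  | CSet x e => setv s x (eval e s)
  | CPut a e1 e2 => seta s a (eval e1 s) (eval e2 s)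
  | CRead x e => let y := eval e s in if in_raw y then setv s x (rw s y) else s
  | CWrite e1 e2 => let y := eval e1 s in if in_raw y then setw s y (eval e2 s) else s
  | CSeq c1 c2 => run_cmd c2 (run_cmd c1 s)
  | CIf e c1 c2 => if Nat.eqb (eval e s) 0 then run_cmd c2 s else run_cmd c1 s
  | CFor x c => nat_rect (fun _ => st) s (fun j s' => run_cmd c (setv s' x j)) n
  end.

End Semantics.

(** Register layout: 0 and 1 keep [n] and [k], 2 holds zero (so adding it is a move), 3 holds one, 4
    the array base, variables start at 5, and the scratch stack above them grows from [r]. The
    machine cannot multiply, so the stride [Q] of the interleaved arrays becomes [Q] unrolled
    additions. *)
Fixpoint ce (r : nat) (e : expr) : list instr :=
  match e with
  | EN => [IAdd r 0 2]
  | EK => [IAdd r 1 2]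
  | EC c => [IConst r c]
  | EV x => [IAdd r (5 + x) 2]
  | EAdd e1 e2 => ce r e1 ++ ce (S r) e2 ++ [IAdd r r (S r)]
  | ESub e1 e2 => ce r e1 ++ ce (S r) e2 ++ [ISub r r (S r)]
  | EArr a e => ce r e ++ IAdd (S r) 4 2 :: repeat (IAdd (S r) (S r) r) Q
                  ++ [IConst r a; IAdd r r (S r); ILoad r r]
  end.

(** [d] is the number of scratch registers available from the target on; a pending left operand
    occupies one, hence [d - 1] for the right one. *)
Fixpoint wfe (e : expr) (d : nat) : bool :=
  match e with
  | EN | EK | EC _ => 1 <=? d
  | EV x => (1 <=? d) && (x <? NV)
  | EAdd e1 e2 | ESub e1 e2 => wfe e1 d && (1 <=? d) && wfe e2 (d - 1)
  | EArr a e => wfe e d && (2 <=? d) && (a <? Q)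
  end.

(* Reads and writes of the raw region are guarded so that the semantics is total. *)
Definition guard (r end_ : nat) (g : nat) : list instr :=
  [IAdd g r 3; IConst (S g) NR; ISub g g (S g); IJz g end_; ISub g 4 r; IJz g end_].

(** Jump targets are absolute, so [off] records where the code will stand. A loop counts down in
    register [r] and sets its variable to [n] minus the counter, which makes the index ascend from
    0. *)
Fixpoint cc (off r : nat) (c : cmd) : list instr :=
  match c with
  | CSkip => []
  | CSet x e => ce r e ++ [IAdd (5 + x) r 2]
  | CPut a e1 e2 =>
      ce r e1 ++ ce (S r) e2 ++ IAdd (S (S r)) 4 2 :: repeat (IAdd (S (S r)) (S (S r)) r) Q
        ++ [IConst r a; IAdd r r (S (S r)); IStore r (S r)]
  | CRead x e =>
      let C := ce r e in
      C ++ guard r (off + length C + 7) (S r) ++ [ILoad (5 + x) r]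
  | CWrite e1 e2 =>
      let C1 := ce r e1 in
      let C2 := ce (S r) e2 in
      C1 ++ C2 ++ guard r (off + length C1 + length C2 + 7) (S (S r)) ++ [IStore r (S r)]
  | CSeq c1 c2 => let C1 := cc off r c1 in C1 ++ cc (off + length C1) r c2
  | CIf e c1 c2 =>
      let C0 := ce r e in
      let C1 := cc (off + length C0 + 1) r c1 in
      let C2 := cc (off + length C0 + 1 + length C1 + 1) r c2 in
      C0 ++ IJz r (off + length C0 + 1 + length C1 + 1) :: C1 ++
      IJmp (off + length C0 + 1 + length C1 + 1 + length C2) :: C2
  | CFor x c =>
      let C := cc (off + 3) (S r) c in
      IAdd r 0 2 :: IJz r (off + 3 + length C + 2) :: ISub (5 + x) 0 r :: C ++
      [ISub r r 3; IJmp (off + 1)]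
  end.

Fixpoint wfc (c : cmd) (d : nat) : bool :=
  match c with
  | CSkip => true
  | CSet x e => wfe e d && (x <? NV)
  | CPut a e1 e2 => wfe e1 d && (3 <=? d) && wfe e2 (d - 1) && (a <? Q)
  | CRead x e => wfe e d && (3 <=? d) && (x <? NV)
  | CWrite e1 e2 => wfe e1 d && (4 <=? d) && wfe e2 (d - 1)
  | CSeq c1 c2 => wfc c1 d && wfc c2 d
  | CIf e c1 c2 => wfe e d && wfc c1 d && wfc c2 d
  | CFor x c => (1 <=? d) && wfc c (d - 1) && (x <? NV)
  end.

(** An upper bound only: a conditional is charged for both branches. Each loop pass has 4 control
    instructions, and 2 more are spent on setup and on the final test. *)
Fixpoint cost (n r : nat) (c : cmd) : nat :=
  match c with
  | CFor x c => 2 + n * (4 + cost n (S r) c)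
  | CSeq c1 c2 => cost n r c1 + cost n r c2
  | CIf e c1 c2 => length (ce r e) + 2 + (cost n r c1 + cost n r c2)
  | _ => length (cc 0 r c)
  end.

Lemma cost_poly c : forall r, exists a d, forall n, cost n r c <= a * (n + 2) ^ d.
Proof.
  induction c; intros r;
    try (match goal with |- context [cost _ r ?c] => exists (length (cc 0 r c)), 0 end;
         intros n; cbn [cost]; rewrite Nat.pow_0_r; lia).
  - destruct (IHc1 r) as (a1 & d1 & H1), (IHc2 r) as (a2 & d2 & H2).
    exists (a1 + a2), (d1 + d2). intros n. cbn [cost].
    specialize (H1 n); specialize (H2 n). rewrite Nat.pow_add_r.
    assert (1 <= (n + 2) ^ d1) by (apply Nat.neq_0_lt_0, Nat.pow_nonzero; lia).
    assert (1 <= (n + 2) ^ d2) by (apply Nat.neq_0_lt_0, Nat.pow_nonzero; lia).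
    nia.
  - destruct (IHc1 r) as (a1 & d1 & H1), (IHc2 r) as (a2 & d2 & H2).
    exists (length (ce r e) + 2 + (a1 + a2)), (d1 + d2). intros n. cbn [cost].
    specialize (H1 n); specialize (H2 n). rewrite Nat.pow_add_r.
    assert (1 <= (n + 2) ^ d1) by (apply Nat.neq_0_lt_0, Nat.pow_nonzero; lia).
    assert (1 <= (n + 2) ^ d2) by (apply Nat.neq_0_lt_0, Nat.pow_nonzero; lia).
    set (l := length (ce r e)). nia.
  - destruct (IHc (S r)) as (a & d & H). exists (6 + a), (S d). intros n. cbn [cost].
    specialize (H n). rewrite Nat.pow_succ_r'.
    assert (1 <= (n + 2) ^ d) by (apply Nat.neq_0_lt_0, Nat.pow_nonzero; lia).
    nia.
Qed.

(** * Simulation of loop programs by compiled code *)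

Section Correctness.
Hypothesis HNR : 5 + NV <= NR.
Variables (n k : nat) (P : program).
Notation bs := (base n).

(** Scratch registers are left unconstrained, so they may be overwritten without breaking the
    simulation. *)
Definition sim (s : st) (m : nat -> nat) : Prop :=
  m 0 = n /\ m 1 = k /\ m 2 = 0 /\ m 3 = 1 /\ m 4 = bs /\
  (forall x, x < NV -> m (5 + x) = vr s x) /\
  (forall a i, a < Q -> m (bs + i * Q + a) = ar s a i) /\
  (forall y, NR <= y < bs -> m y = rw s y).

Lemma base_ge : NR <= bs.
Proof. unfold base. lia. Qed.

Lemma sim_agree s m m' r : 5 + NV <= r -> r <= NR -> sim s m ->
  (forall y, y < r \/ NR <= y -> m' y = m y) -> sim s m'.
Proof.
  intros Hr Hr' (h0 & h1 & h2 & h3 & h4 & hv & ha & hw) H. pose proof base_ge.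
  repeat split; intros; rewrite H by lia; auto.
Qed.

Ltac updr := repeat (rewrite upd_same || rewrite upd_other by lia).
Ltac st1 H := (eapply steps_cons; [exact H | cbn [next fst snd]]).

Lemma rep_add d r q : forall pc m, d <> r ->
  code_at P pc (repeat (IAdd d d r) q) ->
  exists m', steps P q pc m (pc + q) m' /\ m' d = m d + q * m r /\
             forall y, y <> d -> m' y = m y.
Proof.
  induction q as [|q IH]; intros pc m Hd Hc.
  - exists m. rewrite Nat.add_0_r. split; [apply steps_refl|split; [lia|auto]].
  - cbn in Hc. destruct Hc as [Hi Hc].
    destruct (IH (S pc) (upd m d (m d + m r)) Hd Hc) as (m' & S1 & E1 & E2).
    exists m'. split; [|split].
    + st1 Hi. now rewrite <- Nat.add_succ_comm.
    + rewrite E1, upd_same, upd_other by auto. lia.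
    + intros y Hy. rewrite E2 by auto. now apply upd_other.
Qed.

Lemma ce_ok e : forall s m r pc d, sim s m -> wfe e d = true -> r + d <= NR -> 5 + NV <= r ->
  code_at P pc (ce r e) ->
  exists m', steps P (length (ce r e)) pc m (pc + length (ce r e)) m' /\ m' r = eval n k e s /\
             forall y, y < r \/ NR <= y -> m' y = m y.
Proof.
  assert (Hleaf : forall i v m r pc d, next i pc m = (S pc, upd m r v) -> (1 <=? d) = true ->
    r + d <= NR -> code_at P pc [i] -> exists m', steps P 1 pc m (pc + 1) m' /\ m' r = v /\
      forall y, y < r \/ NR <= y -> m' y = m y).
  { intros i v m r pc d E W Hd Hc. apply Nat.leb_le in W. destruct Hc as [Hc _].
    exists (upd m r v). split; [|split].
    - st1 Hc. rewrite E, Nat.add_1_r. apply steps_refl.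
    - apply upd_same.
    - intros y Hy. apply upd_other. lia. }
  induction e; intros s m r pc d Hs Hw Hd Hr Hc; cbn [ce wfe eval] in *.
  - eapply Hleaf; eauto. cbn. destruct Hs as (-> & _ & -> & _). now rewrite Nat.add_0_r.
  - eapply Hleaf; eauto. cbn. destruct Hs as (_ & -> & -> & _). now rewrite Nat.add_0_r.
  - eapply Hleaf; eauto. reflexivity.
  - rewrite andb_true_iff in Hw. destruct Hw as [W1 W2]. apply Nat.ltb_lt in W2.
    eapply Hleaf; eauto. cbn [next]. destruct Hs as (_ & _ & -> & _ & _ & hv & _).
    rewrite (hv x W2). now rewrite Nat.add_0_r.
  - rewrite !andb_true_iff in Hw. destruct Hw as [[W1 W0] W2]. apply Nat.leb_le in W0.
    rewrite !code_at_app in Hc. destruct Hc as (C1 & C2 & C3 & _).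
    destruct (IHe1 s m r pc d) as (m1 & S1 & V1 & A1); auto.
    destruct (IHe2 s m1 (S r) (pc + length (ce r e1)) (d - 1)) as (m2 & S2 & V2 & A2); auto; try lia.
    { eapply sim_agree with (r := r); eauto; lia. }
    eexists. split; [|split].
    + rewrite !length_app. cbn [length]. rewrite !Nat.add_assoc.
      eapply steps_trans; [eapply steps_trans; [exact S1|exact S2]|].
      rewrite Nat.add_1_r. st1 C3. apply steps_refl.
    + rewrite upd_same. rewrite V2, A2 by lia. now rewrite V1.
    + intros y Hy. rewrite upd_other by lia. rewrite A2, A1 by lia. reflexivity.
  - rewrite !andb_true_iff in Hw. destruct Hw as [[W1 W0] W2]. apply Nat.leb_le in W0.
    rewrite !code_at_app in Hc. destruct Hc as (C1 & C2 & C3 & _).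
    destruct (IHe1 s m r pc d) as (m1 & S1 & V1 & A1); auto.
    destruct (IHe2 s m1 (S r) (pc + length (ce r e1)) (d - 1)) as (m2 & S2 & V2 & A2); auto; try lia.
    { eapply sim_agree with (r := r); eauto; lia. }
    eexists. split; [|split].
    + rewrite !length_app. cbn [length]. rewrite !Nat.add_assoc.
      eapply steps_trans; [eapply steps_trans; [exact S1|exact S2]|].
      rewrite Nat.add_1_r. st1 C3. apply steps_refl.
    + rewrite upd_same. rewrite V2, A2 by lia. now rewrite V1.
    + intros y Hy. rewrite upd_other by lia. rewrite A2, A1 by lia. reflexivity.
  - rewrite !andb_true_iff in Hw. destruct Hw as [[W1 W0] W2]. apply Nat.leb_le in W0.
    apply Nat.ltb_lt in W2.
    rewrite code_at_app in Hc. destruct Hc as (C1 & C2). cbn [code_at] in C2.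
    destruct C2 as [C2 C3]. rewrite code_at_app in C3. destruct C3 as (C3 & C4 & C5 & C6 & _).
    destruct (IHe s m r pc d) as (m1 & S1 & V1 & A1); auto.
    destruct Hs as (h0 & h1 & h2 & h3 & h4 & hv & ha & hw).
    destruct (rep_add (S r) r Q (S (pc + length (ce r e))) (upd m1 (S r) (m1 4 + m1 2)))
      as (m2 & S2 & V2 & A2); [lia|exact C3|].
    assert (Hb := base_ge). rewrite repeat_length in *.
    eexists. split; [|split].
    + rewrite length_app. cbn [length]. rewrite length_app, repeat_length. cbn [length].
      eapply steps_trans; [exact S1|]. st1 C2.
      eapply steps_trans; [exact S2|].
      st1 C4. st1 C5. st1 C6.
      replace (S (S (S (S (pc + length (ce r e)) + Q)))) with (pc + (length (ce r e) + S (Q + 3))) by lia.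
      apply steps_refl.
    + rewrite upd_same. rewrite upd_same. rewrite upd_same. rewrite (upd_other _ r a (S r)) by lia.
      rewrite V2. rewrite upd_same, (upd_other m1 (S r)), V1 by lia.
      rewrite !(A1 4), (A1 2), h4, h2 by lia.
      replace (a + (bs + 0 + Q * eval n k e s)) with (bs + eval n k e s * Q + a) by lia.
      rewrite !upd_other by lia. rewrite A2 by lia. rewrite upd_other by lia.
      rewrite A1 by lia. now apply ha.
    + intros y Hy. rewrite !upd_other by lia. rewrite A2 by lia. rewrite upd_other by lia.
      apply A1; lia.
Qed.

(** Adding 1 before the truncated subtraction of [NR] makes the result nonzero exactly when
    [NR <= m r]; the second test, [bs - m r], is strict already. *)
Lemma guard_ok m r g pc end_ : r < g -> S g < NR -> m 3 = 1 -> m 4 = bs -> 5 <= r ->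
  code_at P pc (guard r end_ g) ->
  exists m' t, t <= 6 /\ steps P t pc m (if in_raw n (m r) then pc + 6 else end_) m' /\
    forall y, y < g \/ NR <= y -> m' y = m y.
Proof.
  intros Hrg Hg h3 h4 Hr Hc. cbn in Hc. destruct Hc as (C1 & C2 & C3 & C4 & C5 & C6 & _).
  unfold in_raw.
  destruct (Nat.leb_spec NR (m r)) as [L|L]; cbn [andb].
  - eexists. exists 6. split; [lia|split].
    + st1 C1. st1 C2. st1 C3. st1 C4.
      updr. rewrite h3.
      replace (m r + 1 - NR =? 0) with false by (symmetry; apply Nat.eqb_neq; lia).
      st1 C5. st1 C6. updr. rewrite h4.
      replace (bs - m r =? 0) with (negb (m r <? bs)).
      * destruct (m r <? bs); cbn [negb];
          replace (pc + 6) with (S (S (S (S (S (S pc)))))) by lia; apply steps_refl.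
      * destruct (Nat.ltb_spec (m r) bs); cbn [negb]; symmetry;
          [apply Nat.eqb_neq | apply Nat.eqb_eq]; lia.
    + intros y Hy. cbn beta. rewrite !upd_other by lia. reflexivity.
  - eexists. exists 4. split; [lia|split].
    + st1 C1. st1 C2. st1 C3. st1 C4.
      updr. rewrite h3.
      replace (m r + 1 - NR =? 0) with true by (symmetry; apply Nat.eqb_eq; lia).
      apply steps_refl.
    + intros y Hy. cbn beta. rewrite !upd_other by lia. reflexivity.
Qed.

Lemma sim_setv s m x v : x < NV -> sim s m -> sim (setv s x v) (upd m (5 + x) v).
Proof.
  intros Hx (h0 & h1 & h2 & h3 & h4 & hv & ha & hw). assert (Hb := base_ge).
  unfold sim. repeat split; try (rewrite upd_other by lia; assumption).
  - intros y Hy. change (upd m (5 + x) v (5 + y) = upd (vr s) x v y). destruct (Nat.eq_dec x y) as [->|N].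
    + now rewrite !upd_same.
    + rewrite (upd_other m), (upd_other (vr s)) by lia. auto.
  - intros a i Hai. rewrite upd_other by lia. cbn [setv setw seta vr ar rw]. auto.
  - intros y Hy. rewrite upd_other by lia. cbn [setv setw seta vr ar rw]. auto.
Qed.

Lemma sim_setw s m y v : NR <= y < bs -> sim s m -> sim (setw s y v) (upd m y v).
Proof.
  intros Hx (h0 & h1 & h2 & h3 & h4 & hv & ha & hw). assert (Hb := base_ge).
  unfold sim. repeat split; try (rewrite upd_other by lia; assumption).
  - intros z Hz. rewrite upd_other by lia. cbn [setv setw seta vr ar rw]. auto.
  - intros a i Hai. rewrite upd_other by lia. cbn [setv setw seta vr ar rw]. auto.
  - intros z Hz. cbn [setw rw]. destruct (Nat.eq_dec z y) as [->|N].
    + now rewrite !upd_same.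
    + rewrite (upd_other m), (upd_other (rw s)) by lia. auto.
Qed.

Lemma interleave_inj a b i j : a < Q -> b < Q -> i * Q + a = j * Q + b -> i = j /\ a = b.
Proof.
  intros Ha Hb H. destruct (Nat.div_mod_unique Q i j a b Ha Hb); [lia|]. now split.
Qed.

Lemma sim_seta s m a i v : a < Q -> sim s m -> sim (seta s a i v) (upd m (bs + i * Q + a) v).
Proof.
  intros Ha (h0 & h1 & h2 & h3 & h4 & hv & ha & hw). assert (Hb := base_ge).
  unfold sim. repeat split; try (rewrite upd_other by lia; assumption).
  - intros y Hy. rewrite upd_other by lia. cbn [setv setw seta vr ar rw]. auto.
  - intros b j Hbj. cbn [seta ar].
    destruct (Nat.eq_dec (bs + j * Q + b) (bs + i * Q + a)) as [Eq|Neq].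
    + destruct (interleave_inj b a j i) as [-> ->]; try lia.
      now rewrite Nat.eqb_refl, !upd_same.
    + rewrite upd_other by lia. destruct (Nat.eqb_spec b a) as [->|]; [|auto].
      rewrite upd_other by (intros ->; apply Neq; reflexivity). auto.
  - intros y Hy. rewrite upd_other by lia. cbn [setv setw seta vr ar rw]. auto.
Qed.

Lemma length_guard r e g : length (guard r e g) = 6.
Proof. reflexivity. Qed.

(** The last conclusion protects the counters of enclosing loops: a body compiled at [S r] leaves
    register [r] intact. *)
Theorem cc_ok c : forall s m r off d, sim s m -> wfc c d = true -> r + d <= NR -> 5 + NV <= r ->
  code_at P off (cc off r c) ->
  exists m' t, t <= cost n r c /\ steps P t off m (off + length (cc off r c)) m' /\
    sim (run_cmd n k c s) m' /\ forall y, 5 + NV <= y < r -> m' y = m y.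
Proof.
  assert (Hb := base_ge).
  induction c; intros s m r off d Hs Hw Hd Hr Hc; cbn [wfc] in Hw;
    rewrite ?andb_true_iff in Hw.
  - exists m, 0. cbn. rewrite Nat.add_0_r. repeat split; auto; try apply steps_refl; apply Hs.
  - destruct Hw as [W1 W2]. apply Nat.ltb_lt in W2.
    cbn [cc] in Hc. rewrite code_at_app in Hc. destruct Hc as (C1 & C2 & _).
    destruct (ce_ok e s m r off d) as (m1 & S1 & V1 & A1); auto.
    eexists. exists (length (ce r e) + 1). split; [|split; [|split]].
    + cbn. rewrite length_app. cbn. lia.
    + cbn [cc]. rewrite length_app. cbn [length]. rewrite Nat.add_assoc.
      eapply steps_trans; [exact S1|]. st1 C2. rewrite Nat.add_1_r. apply steps_refl.
    + assert (Hs1 : sim s m1) by (eapply sim_agree with (r := r); eauto; lia).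
      assert (m1 2 = 0) as -> by apply Hs1. rewrite Nat.add_0_r, V1. cbn [run_cmd].
      now apply sim_setv.
    + intros y Hy. rewrite upd_other by lia. apply A1; lia.
  - destruct Hw as [[[W1 W0] W2] W3]. apply Nat.ltb_lt in W3. apply Nat.leb_le in W0.
    cbn [cc] in Hc. rewrite !code_at_app in Hc. cbn [code_at] in Hc.
    rewrite code_at_app, repeat_length in Hc.
    destruct Hc as (C1 & C2 & C3 & C4 & C5 & C6 & C7 & _).
    destruct (ce_ok e1 s m r off d) as (m1 & S1 & V1 & A1); auto.
    assert (Hs1 : sim s m1) by (eapply sim_agree with (r := r); eauto; lia).
    destruct (ce_ok e2 s m1 (S r) (off + length (ce r e1)) (d - 1)) as (m2 & S2 & V2 & A2); auto; try lia.
    assert (Hs2 : sim s m2) by (eapply sim_agree with (r := r); eauto; try lia; intros; apply A2; lia).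
    destruct (rep_add (S (S r)) r Q (S (off + length (ce r e1) + length (ce (S r) e2)))
      (upd m2 (S (S r)) (m2 4 + m2 2))) as (m3 & S3 & V3 & A3); [lia|exact C4|].
    eexists. eexists. split; [|split; [|split]].
    2: { eapply steps_trans; [exact S1|]. eapply steps_trans; [exact S2|].
         st1 C3. eapply steps_trans; [exact S3|]. st1 C5. st1 C6. st1 C7.
         cbn [cc]. rewrite !length_app. cbn [length]. rewrite length_app, repeat_length. cbn [length].
         match goal with |- steps _ _ ?x _ ?y _ => replace y with x by lia end. apply steps_refl. }
    + cbn. rewrite !length_app. cbn. rewrite length_app, repeat_length. cbn. lia.
    + cbn [run_cmd]. rewrite upd_same, upd_same, (upd_other _ r a (S (S r))) by lia.
      rewrite !(upd_other _ r _ (S r)) by lia.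
      rewrite V3, upd_same, (upd_other m2), (A3 (S r)), upd_other, V2 by lia.
      rewrite (A2 r), V1 by lia.
      assert (m2 4 = bs) as -> by apply Hs2. assert (m2 2 = 0) as -> by apply Hs2.
      replace (a + (bs + 0 + Q * eval n k e1 s)) with (bs + eval n k e1 s * Q + a) by lia.
      apply sim_seta; [exact W3|].
      eapply sim_agree with (r := r) (m := m2); eauto; try lia.
      intros y Hy. rewrite !upd_other by lia. rewrite A3 by lia. apply upd_other; lia.
    + intros y Hy. rewrite upd_same, upd_same, (upd_other _ r a (S (S r))) by lia.
      rewrite V3, upd_same, (upd_other m2) by lia. assert (m2 4 = bs) as -> by apply Hs2.
      rewrite !upd_other by lia. rewrite A3 by lia. rewrite upd_other by lia.
      rewrite A2, A1 by lia. reflexivity.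
  - destruct Hw as [[W1 W0] W2]. apply Nat.ltb_lt in W2. apply Nat.leb_le in W0.
    cbn [cc] in Hc. rewrite !code_at_app in Hc. destruct Hc as (C1 & C2 & C3 & _).
    rewrite length_guard in C3.
    destruct (ce_ok e s m r off d) as (m1 & S1 & V1 & A1); auto.
    assert (Hs1 : sim s m1) by (eapply sim_agree with (r := r); eauto; lia).
    destruct (guard_ok m1 r (S r) _ _ ltac:(lia) ltac:(lia) ltac:(apply Hs1) ltac:(apply Hs1) ltac:(lia) C2)
      as (m2 & t2 & T2 & S2 & A2).
    assert (Hs2 : sim s m2) by (eapply sim_agree with (r := r); eauto; try lia; intros; apply A2; lia).
    cbn [run_cmd]. rewrite V1 in S2.
    assert (Hlen : off + length (cc off r (CRead x e)) = off + length (ce r e) + 7).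
    { cbn [cc]. rewrite !length_app, length_guard. cbn. lia. }
    rewrite Hlen.
    destruct (in_raw n (eval n k e s)) eqn:G.
    + eexists. eexists. split; [|split; [|split]].
      2: { eapply steps_trans; [exact S1|]. eapply steps_trans; [exact S2|]. st1 C3.
           replace (off + length (ce r e) + 7) with (S (off + length (ce r e) + 6)) by lia. apply steps_refl. }
      * cbn [cost cc]. rewrite !length_app, length_guard. cbn [length]. lia.
      * rewrite (A2 r), V1 by lia.
        unfold in_raw in G. rewrite andb_true_iff, Nat.leb_le, Nat.ltb_lt in G.
        assert (m2 (eval n k e s) = rw s (eval n k e s)) as -> by (apply Hs2; exact G).
        now apply sim_setv.
      * intros y Hy. rewrite upd_other by lia. rewrite A2, A1 by lia. reflexivity.
    + eexists. eexists. split; [|split; [|split]].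
      2: { eapply steps_trans; [exact S1|exact S2]. }
      * cbn [cost cc]. rewrite !length_app, length_guard. cbn [length]. lia.
      * exact Hs2.
      * intros y Hy. rewrite A2, A1 by lia. reflexivity.
  - destruct Hw as [[W1 W0] W2]. apply Nat.leb_le in W0.
    cbn [cc] in Hc. rewrite !code_at_app in Hc. destruct Hc as (C1 & C2 & C3 & C4 & _).
    rewrite length_guard in C4.
    destruct (ce_ok e1 s m r off d) as (m1 & S1 & V1 & A1); auto.
    assert (Hs1 : sim s m1) by (eapply sim_agree with (r := r); eauto; lia).
    destruct (ce_ok e2 s m1 (S r) (off + length (ce r e1)) (d - 1)) as (m2 & S2 & V2 & A2); auto; try lia.
    assert (Hs2 : sim s m2) by (eapply sim_agree with (r := r); eauto; try lia; intros; apply A2; lia).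
    destruct (guard_ok m2 r (S (S r)) _ _ ltac:(lia) ltac:(lia) ltac:(apply Hs2) ltac:(apply Hs2) ltac:(lia) C3)
      as (m3 & t3 & T3 & S3 & A3).
    assert (Hs3 : sim s m3) by (eapply sim_agree with (r := r); eauto; try lia; intros; apply A3; lia).
    cbn [run_cmd]. rewrite (A2 r), V1 in S3 by lia.
    assert (Hlen : off + length (cc off r (CWrite e1 e2)) = off + length (ce r e1) + length (ce (S r) e2) + 7).
    { cbn [cc]. rewrite !length_app, length_guard. cbn. lia. }
    rewrite Hlen.
    destruct (in_raw n (eval n k e1 s)) eqn:G.
    + assert (G' := G). unfold in_raw in G'. rewrite andb_true_iff, Nat.leb_le, Nat.ltb_lt in G'.
      eexists. eexists. split; [|split; [|split]].
      2: { eapply steps_trans; [exact S1|]. eapply steps_trans; [exact S2|].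
           eapply steps_trans; [exact S3|]. st1 C4.
           match goal with |- steps _ _ ?x _ ?y _ => replace y with x by lia end. apply steps_refl. }
      * cbn [cost cc]. rewrite !length_app, length_guard. cbn [length]. lia.
      * rewrite (A3 r), (A2 r), V1, (A3 (S r)), V2 by lia. now apply sim_setw.
      * intros y Hy. rewrite (A3 r), (A2 r), V1 by lia.
        rewrite upd_other by lia. rewrite A3, A2, A1 by lia. reflexivity.
    + eexists. eexists. split; [|split; [|split]].
      2: { eapply steps_trans; [exact S1|]. eapply steps_trans; [exact S2|]. exact S3. }
      * cbn [cost cc]. rewrite !length_app, length_guard. cbn [length]. lia.
      * exact Hs3.
      * intros y Hy. rewrite A3, A2, A1 by lia. reflexivity.
  - destruct Hw as [W1 W2]. cbn [cc] in *. rewrite code_at_app in Hc. destruct Hc as (C1 & C2).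
    destruct (IHc1 s m r off d) as (m1 & t1 & T1 & S1 & M1 & A1); auto.
    destruct (IHc2 (run_cmd n k c1 s) m1 r (off + length (cc off r c1)) d) as (m2 & t2 & T2 & S2 & M2 & A2); auto.
    exists m2, (t1 + t2). split; [|split; [|split]].
    + cbn [cost]. lia.
    + rewrite length_app, Nat.add_assoc. eapply steps_trans; [exact S1|exact S2].
    + exact M2.
    + intros y Hy. rewrite A2, A1; auto.
  - destruct Hw as [[W1 W2] W3]. cbn [cc] in *.
    rewrite code_at_app in Hc. cbn [code_at] in Hc. rewrite code_at_app in Hc. cbn [code_at] in Hc.
    destruct Hc as (C0 & CJ & C1 & CK & C2).
    rewrite length_app. cbn [length]. rewrite length_app. cbn [length].
    destruct (ce_ok e s m r off d) as (m1 & S1 & V1 & A1); auto.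
    assert (Hs1 : sim s m1) by (eapply sim_agree with (r := r); eauto; lia).
    cbn [run_cmd].
    assert (E1 : S (off + length (ce r e)) = off + length (ce r e) + 1) by lia.
    rewrite E1 in *.
    destruct (eval n k e s =? 0) eqn:G.
    + assert (E2 : S (off + length (ce r e) + 1 + length (cc (off + length (ce r e) + 1) r c1))
        = off + length (ce r e) + 1 + length (cc (off + length (ce r e) + 1) r c1) + 1) by lia.
      rewrite E2 in C2.
      destruct (IHc2 s m1 r _ d Hs1 W3 Hd Hr C2) as (m2 & t2 & T2 & S2 & M2 & A2).
      exists m2. eexists. split; [|split; [|split]].
      2: { eapply steps_trans; [exact S1|]. st1 CJ. rewrite V1, G.
           eapply steps_trans; [exact S2|].
           match goal with |- steps _ _ ?x _ ?y _ => replace y with x by lia end. apply steps_refl. }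
      * cbn [cost]. lia.
      * exact M2.
      * intros y Hy. rewrite A2, A1; auto; lia.
    + destruct (IHc1 s m1 r _ d Hs1 W2 Hd Hr C1) as (m2 & t2 & T2 & S2 & M2 & A2).
      exists m2. eexists. split; [|split; [|split]].
      2: { eapply steps_trans; [exact S1|]. st1 CJ. rewrite V1, G, E1.
           eapply steps_trans; [exact S2|]. st1 CK.
           match goal with |- steps _ _ ?x _ ?y _ => replace y with x by lia end. apply steps_refl. }
      * cbn [cost]. lia.
      * exact M2.
      * intros y Hy. rewrite A2, A1; auto; lia.
  - destruct Hw as [[W0 W1] W2]. apply Nat.leb_le in W0. apply Nat.ltb_lt in W2. cbn [cc] in *.
    cbn [code_at] in Hc. rewrite code_at_app in Hc. cbn [code_at] in Hc.
    destruct Hc as (C0 & C1 & C2 & C3 & C4 & C5 & _).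
    set (C := cc (off + 3) (S r) c) in *.
    assert (E3 : S (S (S off)) = off + 3) by lia. rewrite E3 in *.
    assert (Hloop : forall j, j <= n -> exists m' t, t <= 1 + j * (4 + cost n (S r) c) /\
      steps P t off m (S off) m' /\
      sim (nat_rect (fun _ => st) s (fun j s' => run_cmd n k c (setv s' x j)) j) m' /\
      m' r = n - j /\ forall y, 5 + NV <= y < r -> m' y = m y).
    { induction j as [|j IHj]; intros Hj.
      - eexists. exists 1. split; [lia|]. split; [st1 C0; apply steps_refl|].
        cbn [nat_rect]. split; [|split].
        + eapply sim_agree with (r := r) (m := m); eauto; try lia.
          intros y Hy. apply upd_other. lia.
        + rewrite upd_same. destruct Hs as (-> & _ & -> & _). lia.
        + intros y Hy. apply upd_other. lia.
      - destruct IHj as (m1 & t1 & T1 & S1 & M1 & R1 & A1); [lia|].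
        set (s1 := nat_rect (fun _ => st) s (fun j s' => run_cmd n k c (setv s' x j)) j) in *.
        assert (M1' : sim (setv s1 x j) (upd m1 (5 + x) j)) by now apply sim_setv.
        destruct (IHc _ _ (S r) (off + 3) (d - 1) M1' W1 ltac:(lia) ltac:(lia) C3)
          as (m2 & t2 & T2 & S2 & M2 & A2). fold C in S2.
        assert (R2 : m2 r = n - j) by (rewrite A2 by lia; rewrite upd_other by lia; exact R1).
        assert (m2 3 = 1) by apply M2.
        eexists. eexists. split; [|split; [|split; [|split]]].
        2: { eapply steps_trans; [exact S1|]. st1 C1. rewrite R1.
             replace (n - j =? 0) with false by (symmetry; apply Nat.eqb_neq; lia).
             st1 C2. rewrite R1. assert (m1 0 = n) as -> by apply M1.
             replace (n - (n - j)) with j by lia. rewrite E3.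
             eapply steps_trans; [exact S2|]. st1 C4. st1 C5.
             replace (off + 1) with (S off) by lia. apply steps_refl. }
        + cbn [Nat.mul]. lia.
        + cbn [nat_rect]. fold s1. eapply sim_agree with (r := r) (m := m2); eauto; try lia.
          intros y Hy. apply upd_other. lia.
        + rewrite upd_same, R2. lia.
        + intros y Hy. rewrite upd_other by lia. rewrite A2 by lia. rewrite upd_other by lia. auto. }
    destruct (Hloop n (le_n _)) as (m1 & t1 & T1 & S1 & M1 & R1 & A1).
    exists m1. eexists. split; [|split; [|split]].
    2: { eapply steps_trans; [exact S1|]. st1 C1. rewrite R1, Nat.sub_diag. cbn [Nat.eqb].
         cbn [length]. rewrite length_app. cbn [length].
         match goal with |- steps _ _ ?x _ ?y _ => replace y with x by lia end. apply steps_refl. }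
    + cbn [cost]. lia.
    + exact M1.
    + exact A1.
Qed.


(** * Saving the low input cells before the run and restoring the low output cells after it *)

Definition pack : list instr := flat_map (fun i => [IAdd 2 2 2; IAdd 2 2 i]) (seq 3 (NR - 3)).

(** Cell 2 is itself the accumulator, so its own bit becomes the leading one and it must not be read
    again. *)
Lemma pack_ok l : forall pc m, ~ In 2 l ->
  code_at P pc (flat_map (fun i => [IAdd 2 2 2; IAdd 2 2 i]) l) ->
  exists m', steps P (2 * length l) pc m (pc + 2 * length l) m' /\
    m' 2 = fold_left (fun a j => a + a + m j) l (m 2) /\ forall y, y <> 2 -> m' y = m y.
Proof.
  induction l as [|i l IH]; intros pc m Hl Hc.
  - exists m. cbn. rewrite Nat.add_0_r. split; [apply steps_refl|auto].
  - cbn [flat_map app code_at] in Hc. destruct Hc as (C1 & C2 & C3).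
    assert (i <> 2 /\ ~ In 2 l) as [Hi Hl'] by (cbn in Hl; split; intros ?; apply Hl; auto).
    destruct (IH _ (upd (upd m 2 (m 2 + m 2)) 2 (upd m 2 (m 2 + m 2) 2 + upd m 2 (m 2 + m 2) i)) Hl' C3)
      as (m' & S1 & V & A).
    exists m'. split; [|split].
    + cbn [length]. replace (2 * S (length l)) with (S (S (2 * length l))) by lia.
      st1 C1. st1 C2.
      match goal with |- steps _ _ _ _ ?y _ => replace y with (S (S pc) + 2 * length l) by lia end. exact S1.
    + rewrite V. cbn [fold_left]. updr.
      assert (E : forall a m2, (forall y, y <> 2 -> m2 y = m y) ->
        fold_left (fun a j => a + a + m2 j) l a = fold_left (fun a j => a + a + m j) l a).
      { clear - Hl'. induction l as [|j l IH]; intros a m2 H2; cbn; [reflexivity|].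
        rewrite H2 by (intros ->; apply Hl'; now left).
        apply IH; auto. intros H; apply Hl'; now right. }
      apply E. intros y Hy. updr. reflexivity.
    + intros y Hy. rewrite A by auto. updr. reflexivity.
Qed.

(** A move needs a zero register, and register 2 is still occupied by the packed value: the already
    packed cell 3 is cleared to serve as one. The base address is then reached by [n] additions of
    [n], counted down in register 6. *)
Definition prologue : list instr :=
  pack ++ [IConst 3 0; IAdd 5 2 3; IConst 2 0; IConst 3 1; IConst 4 (NR + 2); IAdd 6 0 2;
           IJz 6 (length pack + 10); IAdd 4 4 0; ISub 6 6 3; IJmp (length pack + 6)].

Lemma length_pack : length pack = 2 * (NR - 3).
Proof.
  unfold pack. rewrite (flat_map_constant_length (c := 2)), length_seq by reflexivity. lia.
Qed.

Lemma prologue_ok m : 7 <= NR -> 1 <= NV -> m 0 = n -> m 1 = k -> code_at P 0 prologue ->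
  exists s m' t, t <= length pack + 7 + 4 * n /\ steps P t 0 m (length prologue) m' /\ sim s m' /\
    vr s 0 = bits_val m 2 (NR - 2) /\ forall y, NR <= y < bs -> rw s y = m y.
Proof.
  intros H7 H1 h0 h1 Hc. assert (Hb := base_ge). unfold prologue in *.
  rewrite code_at_app in Hc. destruct Hc as [Cp Hc]. cbn [code_at] in Hc.
  rewrite Nat.add_0_l in Hc.
  destruct Hc as (C1 & C2 & C3 & C4 & C5 & C6 & C7 & C8 & C9 & C10 & _).
  destruct (pack_ok (seq 3 (NR - 3)) 0 m ltac:(rewrite in_seq; lia) Cp) as (m1 & S1 & V1 & A1).
  rewrite length_seq, Nat.add_0_l, <- length_pack in S1.
  rewrite bits_val_fold in V1.
  assert (Hloop : forall j, j <= n -> exists m' t, t <= length pack + 6 + 4 * j /\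
     steps P t 0 m (length pack + 6) m' /\ m' 0 = n /\ m' 1 = k /\ m' 2 = 0 /\ m' 3 = 1 /\
     m' 4 = NR + 2 + j * n /\ m' 5 = bits_val m 2 (NR - 2) /\ m' 6 = n - j /\
     forall y, NR <= y -> m' y = m y).
  { induction j as [|j IHj]; intros Hj.
    - eexists. eexists. split; [|split].
      2: { eapply steps_trans; [exact S1|]. st1 C1. st1 C2. st1 C3. st1 C4. st1 C5. st1 C6.
           replace (length pack + 6) with (S (S (S (S (S (S (length pack))))))) by lia. apply steps_refl. }
      + lia.
      + updr. rewrite A1 by lia. repeat split; try lia; updr; try (rewrite A1 by lia; lia).
        * rewrite V1, Nat.add_0_r. replace (NR - 2) with (S (NR - 3)) by lia. reflexivity.
        * intros y Hy. updr. apply A1; lia.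
    - destruct IHj as (m2 & t & T & S2 & B0 & B1 & B2 & B3 & B4 & B5 & B6 & A); [lia|].
      eexists. eexists. split; [|split].
      2: { eapply steps_trans; [exact S2|].
           replace (length pack + 6) with (S (S (S (S (S (S (length pack))))))) by lia.
           st1 C7. rewrite B6. replace (n - j =? 0) with false by (symmetry; apply Nat.eqb_neq; lia).
           st1 C8. st1 C9. st1 C10.
           replace (length pack + 6) with (S (S (S (S (S (S (length pack))))))) by lia.
           apply steps_refl. }
      + lia.
      + updr. repeat split; try lia; updr; try lia. intros y Hy. updr. auto. }
  destruct (Hloop n (le_n _)) as (m2 & t & T & S2 & B0 & B1 & B2 & B3 & B4 & B5 & B6 & A).
  exists (St (fun x => m2 (5 + x)) (fun a i => m2 (bs + i * Q + a)) m2), m2, (t + 1).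
  split; [lia|]. split; [|split; [|split]].
  - eapply steps_trans; [exact S2|].
    replace (length pack + 6) with (S (S (S (S (S (S (length pack))))))) by lia.
    st1 C7. rewrite B6, Nat.sub_diag. cbn [Nat.eqb].
    rewrite length_app. cbn [length]. apply steps_refl.
  - repeat split; auto.
  - exact B5.
  - intros y Hy. apply A. lia.
Qed.

(** The output starts at cell 2, so cells 0 and 1 are free to hold the stride and the running
    address while all other registers, the array base included, are overwritten. *)
Definition epilogue (a : nat) : list instr :=
  [IConst 0 a; IAdd 1 4 0; IConst 0 Q] ++ flat_map (fun i => [ILoad i 1; IAdd 1 1 0]) (seq 2 (NR - 2)).

Lemma unload_ok B r : forall i pc m, 2 <= i -> i + r <= NR -> NR <= B -> m 0 = Q -> m 1 = B ->
  code_at P pc (flat_map (fun i => [ILoad i 1; IAdd 1 1 0]) (seq i r)) ->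
  exists m', steps P (2 * r) pc m (pc + 2 * r) m' /\
    (forall j, j < r -> m' (i + j) = m (B + j * Q)) /\
    forall y, 2 <= y < i \/ NR <= y -> m' y = m y.
Proof.
  induction r as [|r IH] in B |- *; intros i pc m Hi Hr HB h0 h1 Hc.
  - exists m. rewrite Nat.mul_0_r, Nat.add_0_r. split; [apply steps_refl|]. split; [lia|auto].
  - cbn [seq flat_map app code_at] in Hc. destruct Hc as (C1 & C2 & C3).
    destruct (IH (B + Q) (S i) (S (S pc)) (upd (upd m i (m (m 1))) 1 (upd m i (m (m 1)) 1 + upd m i (m (m 1)) 0)))
      as (m' & S1 & V & A); try lia; auto.
    + updr. exact h0.
    + updr. lia.
    + exists m'. split; [|split].
      * replace (2 * S r) with (S (S (2 * r))) by lia. st1 C1. st1 C2.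
        match goal with |- steps _ _ _ _ ?y _ => replace y with (S (S pc) + 2 * r) by lia end. exact S1.
      * intros [|j] Hj.
        -- rewrite A by lia. rewrite !Nat.add_0_r. updr. now rewrite h1.
        -- replace (i + S j) with (S i + j) by lia. rewrite V by lia. updr. f_equal. lia.
      * intros y Hy. rewrite A by lia. updr. reflexivity.
Qed.

Lemma epilogue_ok a s m pc : a < Q -> 5 <= NR -> sim s m -> code_at P pc (epilogue a) ->
  exists m', steps P (3 + 2 * (NR - 2)) pc m (pc + length (epilogue a)) m' /\
    (forall i, i < NR - 2 -> m' (2 + i) = ar s a i) /\
    (forall y, NR <= y < bs -> m' y = rw s y).
Proof.
  intros Ha H5 Hs Hc. assert (Hb := base_ge). unfold epilogue in *. rewrite code_at_app in Hc.
  destruct Hc as ((C1 & C2 & C3 & _) & C4). cbn [length] in C4.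
  destruct Hs as (h0 & h1 & h2 & h3 & h4 & hv & ha & hw).
  destruct (unload_ok (bs + a) (NR - 2) 2 (pc + 3) (upd (upd (upd m 0 a) 1 (upd m 0 a 4 + upd m 0 a 0)) 0 Q))
      as (m' & S1 & V & A); try lia; auto.
  - updr. lia.
  - exists m'. split; [|split].
    + st1 C1. st1 C2. st1 C3. replace (S (S (S pc))) with (pc + 3) by lia.
      match goal with |- steps _ _ _ _ ?y _ => replace y with (pc + 3 + 2 * (NR - 2)) end; [exact S1|].
      rewrite length_app. cbn [length].
      rewrite (flat_map_constant_length (c := 2)), length_seq by reflexivity. lia.
    + intros i Hi. rewrite V by lia. updr.
      replace (bs + a + i * Q) with (bs + i * Q + a) by lia. auto.
    + intros y Hy. rewrite A by lia. updr. auto.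
Qed.

End Correctness.

Definition whole (c : cmd) (a : nat) : program :=
  prologue ++ cc (length prologue) (5 + NV) c ++ epilogue a.

Theorem whole_ok c a n k E : 5 + NV <= NR -> 7 <= NR -> 1 <= NV -> a < Q -> wfc c (NR - (5 + NV)) = true ->
  exists s mout t, t <= length pack + 7 + 4 * n + cost n (5 + NV) c + 3 + 2 * (NR - 2) + 1 /\
    exec (whole c a) t 0 (encode_input n k E) = Some mout /\
    vr s 0 = bits_val (encode_input n k E) 2 (NR - 2) /\
    (forall y, NR <= y < base n -> rw s y = encode_input n k E y) /\
    (forall i, i < NR - 2 -> mout (2 + i) = ar (run_cmd n k c s) a i) /\
    (forall y, NR <= y < base n -> mout y = rw (run_cmd n k c s) y).
Proof.
  intros HNR H7 H1 Ha Hw. set (P := whole c a).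
  assert (C0 : code_at P 0 prologue) by apply (code_at_mid []).
  assert (C1 : code_at P (length prologue) (cc (length prologue) (5 + NV) c)) by apply code_at_mid.
  assert (C2 : code_at P (length prologue + length (cc (length prologue) (5 + NV) c)) (epilogue a)).
  { rewrite <- length_app. unfold P, whole. rewrite app_assoc.
    rewrite <- (app_nil_r (epilogue a)) at 1. apply code_at_mid. }
  destruct (prologue_ok HNR n k P (encode_input n k E) H7 H1 eq_refl eq_refl C0)
    as (s & m1 & t1 & T1 & S1 & M1 & V1 & W1).
  destruct (cc_ok HNR n k P c s m1 (5 + NV) _ _ M1 Hw ltac:(lia) ltac:(lia) C1)
    as (m2 & t2 & T2 & S2 & M2 & _).
  destruct (epilogue_ok HNR n k P a _ m2 _ Ha ltac:(lia) M2 C2) as (m3 & S3 & V3 & W3).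
  exists s, m3, (t1 + (t2 + (3 + 2 * (NR - 2))) + 1). split; [lia|].
  split; [|auto].
  (* The extra unit of fuel lets [exec] find the program counter past the end, which is how the
     machine halts. *)
  rewrite (steps_trans _ _ _ _ _ _ _ _ _ S1 (steps_trans _ _ _ _ _ _ _ _ _ S2 S3) 1).
  cbn [exec].
  replace (nth_error P _) with (@None instr); [reflexivity|].
  symmetry. apply nth_error_None. unfold P, whole. rewrite !length_app. lia.
Qed.

End Machine.

(** * Spanners and the greedy bound *)

Definition pairs (n : nat) : list (nat * nat) := list_prod (seq 0 n) (seq 0 n).

Lemma NoDup_list_prod {A B} (l : list A) (l' : list B) :
  NoDup l -> NoDup l' -> NoDup (list_prod l l').
Proof.
  intros Hl Hl'. induction Hl as [|x l Hx Hl IH]; cbn; [constructor|].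
  apply NoDup_app; auto.
  - apply NoDup_map_NoDup_ForallPairs; auto. intros y z _ _ [=]; auto.
  - intros [y z] H1 H2. apply in_map_iff in H1. destruct H1 as (w & [= <- <-] & _).
    apply in_prod_iff in H2. tauto.
Qed.

Lemma in_pairs n i j : In (i, j) (pairs n) <-> i < n /\ j < n.
Proof. unfold pairs. rewrite in_prod_iff, !in_seq. lia. Qed.

Definition edges (n : nat) (f : nat -> nat -> bool) : list (nat * nat) :=
  filter (fun p => f (fst p) (snd p)) (pairs n).

Lemma in_edges n f i j : In (i, j) (edges n f) <-> i < n /\ j < n /\ f i j = true.
Proof. unfold edges. rewrite filter_In, in_pairs. cbn. tauto. Qed.

Lemma NoDup_edges n f : NoDup (edges n f).
Proof. apply NoDup_filter, NoDup_list_prod; apply seq_NoDup. Qed.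

Lemma num_edges_incl n f (l : list (nat * nat)) :
  (forall i j, i < n -> j < n -> f i j = true -> In (i, j) l) -> num_edges n f <= length l.
Proof.
  intros H. apply (NoDup_incl_length (NoDup_edges n f)).
  intros [i j] Hp. apply in_edges in Hp. destruct Hp as (Hi & Hj & Hf). auto.
Qed.

Lemma num_edges_mono n f g :
  (forall i j, i < n -> j < n -> f i j = true -> g i j = true) -> num_edges n f <= num_edges n g.
Proof. intros H. apply (num_edges_incl n f (edges n g)). intros. apply in_edges. auto. Qed.

Lemma num_edges_ext n f g :
  (forall i j, i < n -> j < n -> f i j = g i j) -> num_edges n f = num_edges n g.
Proof. intros H. apply Nat.le_antisymm; apply num_edges_mono; intros; [rewrite <- H|rewrite H]; auto. Qed.

Lemma num_edges_add1 n f g a b :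
  (forall i j, i < n -> j < n -> g i j = true -> f i j = true \/ (i = a /\ j = b)) ->
  num_edges n g <= S (num_edges n f).
Proof.
  intros H. apply (num_edges_incl n g ((a, b) :: edges n f)). intros i j Hi Hj Hg.
  destruct (H i j Hi Hj Hg) as [Hf|[-> ->]]; [right; apply in_edges; auto|now left].
Qed.

Lemma num_edges_split n f g :
  num_edges n (fun i j => f i j && g i j) + num_edges n (fun i j => f i j && negb (g i j)) = num_edges n f.
Proof.
  unfold num_edges. induction (list_prod _ _) as [|[i j] l IH]; cbn; [reflexivity|].
  destruct (f i j), (g i j); cbn; lia.
Qed.

Lemma num_edges_le_square n f : num_edges n f <= n * n.
Proof.
  unfold num_edges. eapply Nat.le_trans; [apply filter_length_le|].
  now rewrite length_prod, length_seq.
Qed.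

Definition outs (n : nat) (f : nat -> nat -> bool) (u : nat) : list nat := filter (f u) (seq 0 n).

Lemma num_edges_list_sum n f :
  num_edges n f = list_sum (map (fun u => length (outs n f u)) (seq 0 n)).
Proof.
  unfold num_edges. induction (seq 0 n) as [|u l IH] at 1 3; cbn; [reflexivity|].
  rewrite filter_app, length_app, IH. f_equal. clear IH. unfold outs.
  induction (seq 0 n) as [|v l' IH']; cbn; [reflexivity|]. destruct (f u v); cbn; lia.
Qed.

Fixpoint sumn (n : nat) (f : nat -> nat) : nat :=
  match n with 0 => 0 | S m => sumn m f + f m end.

Lemma list_sum_cons x l : list_sum (x :: l) = x + list_sum l.
Proof. reflexivity. Qed.

Lemma sumn_list_sum n f : sumn n f = list_sum (map f (seq 0 n)).
Proof.
  induction n as [|n IH]; [reflexivity|].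
  rewrite seq_S, map_app, list_sum_app. cbn. lia.
Qed.

Lemma num_edges_sumn n f : num_edges n f = sumn n (fun u => sumn n (fun v => Nat.b2n (f u v))).
Proof.
  rewrite num_edges_list_sum, sumn_list_sum. f_equal. apply map_ext. intros u.
  rewrite sumn_list_sum. unfold outs.
  induction (seq 0 n) as [|v l IH]; cbn; [reflexivity|]. destruct (f u v); cbn; [f_equal|]; exact IH.
Qed.

(** * Bounded reachability *)

Section Reach.
Variable n : nat.
Implicit Types E H : nat -> nat -> bool.

Lemma reach_refl E m u : reach_le n E m u u.
Proof. destruct m; cbn; auto. Qed.

Lemma reach_mono E m m' u v : m <= m' -> reach_le n E m u v -> reach_le n E m' u v.
Proof.
  revert m' u. induction m as [|m IH]; intros m' u Hm Hr.
  - cbn in Hr. subst. apply reach_refl.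
  - destruct m' as [|m']; [lia|]. destruct Hr as [->|(w & Hw & He & Hr)]; [now left|].
    right. exists w. repeat split; auto. apply IH; [lia|auto].
Qed.

Lemma reach_trans E m m' u w v :
  reach_le n E m u w -> reach_le n E m' w v -> reach_le n E (m + m') u v.
Proof.
  revert u. induction m as [|m IH]; intros u H1 H2.
  - cbn in H1. now subst.
  - destruct H1 as [->|(x & Hx & He & Hr)].
    + eapply reach_mono; [|exact H2]. lia.
    + right. exists x. auto.
Qed.

Lemma reach_edge E u v : v < n -> E u v = true -> reach_le n E 1 u v.
Proof. intros Hv He. right. exists v. cbn. auto. Qed.

Lemma reach_sub E H m u v : u < n ->
  (forall i j, i < n -> j < n -> H i j = true -> E i j = true) ->
  reach_le n H m u v -> reach_le n E m u v.
Proof.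
  intros Hu Hs. revert u Hu. induction m as [|m IH]; intros u Hu; [auto|].
  intros [->|(w & Hw & He & Hr)]; [now left|]. right. exists w. auto.
Qed.

Lemma reach_step E m u v : u <> v -> reach_le n E m u v ->
  exists w, w < n /\ E u w = true /\ reach_le n E (m - 1) w v.
Proof.
  intros Hne. destruct m as [|m]; [now intros ->|]. intros [->|Hw]; [easy|].
  now replace (S m - 1) with m by lia.
Qed.

Lemma reach_last E m u v : u < n -> reach_le n E (S m) u v ->
  u = v \/ exists w, w < n /\ reach_le n E m u w /\ E w v = true.
Proof.
  revert u. induction m as [|m IH]; intros u Hu [->|(w & Hw & He & Hr)]; auto.
  - cbn in Hr. subst. right. exists u. cbn. auto.
  - destruct (IH w Hw Hr) as [->|(x & Hx & Hx1 & Hx2)].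
    + right. exists u. split; [auto|]. split; [apply reach_refl|auto].
    + right. exists x. repeat split; auto. right. exists w. auto.
Qed.

(** Every vertex of the list for the rest of the walk reaches [v] within one step less than the
    minimum for [u], so [u] cannot recur there. *)
Lemma reach_shortest_list E v d : forall u, u < n -> reach_le n E d u v ->
  (forall m, m < d -> ~ reach_le n E m u v) ->
  exists l, length l = S d /\ NoDup l /\ forall z, In z l -> z < n /\ reach_le n E d z v.
Proof.
  induction d as [|d IH]; intros u Hu Hr Hmin.
  - exists [u]. split; [reflexivity|]. split; [constructor; auto; constructor|].
    intros z [<-|[]]. auto.
  - destruct Hr as [->|(w & Hw & He & Hr)].
    { exfalso. apply (Hmin 0); [lia|]. reflexivity. }
    destruct (IH w Hw Hr) as (l & Hl & Hd & Hz).
    { intros m Hm Hr'. apply (Hmin (S m)); [lia|]. right. exists w. auto. }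
    exists (u :: l). split; [cbn; lia|]. split.
    + constructor; auto. intros Hin. apply (Hmin d); [lia|]. now apply Hz.
    + intros z [<-|Hin]; [split; auto; right; exists w; auto|].
      destruct (Hz z Hin). split; auto. eapply reach_mono; [|eassumption]. lia.
Qed.

Lemma reach_dec E m u v : {reach_le n E m u v} + {~ reach_le n E m u v}.
Proof.
  revert u. induction m as [|m IH]; intros u; cbn; [apply Nat.eq_dec|].
  destruct (Nat.eq_dec u v) as [->|N]; [left; auto|].
  destruct (existsb (fun w => E u w && if IH w then true else false) (seq 0 n)) eqn:B.
  - left. right. apply existsb_exists in B. destruct B as (w & Hw & B). apply in_seq in Hw.
    apply andb_true_iff in B. destruct B as [B1 B2]. exists w.
    destruct (IH w); [|discriminate]. repeat split; auto; lia.
  - right. intros [->|(w & Hw & He & Hr)]; [auto|].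
    enough (existsb (fun w => E u w && if IH w then true else false) (seq 0 n) = true) by congruence.
    apply existsb_exists. exists w. split; [apply in_seq; lia|]. rewrite He. cbn.
    destruct (IH w); auto.
Qed.

(** A shortest walk visits distinct vertices, of which there are [n]. Hence [n] relaxation rounds
    are enough for every [k]. *)
Lemma reach_short E m u v : u < n -> reach_le n E m u v -> exists d, d <= m /\ d <= n /\ reach_le n E d u v.
Proof.
  intros Hu. induction m as [|m IH]; intros Hr.
  - exists 0. repeat split; auto; lia.
  - destruct (reach_dec E m u v) as [Hy|Hn].
    + destruct (IH Hy) as (d & ? & ? & ?). exists d. repeat split; auto.
    + destruct (reach_shortest_list E v (S m) u Hu Hr) as (l & Hl & Hd & Hz).
      { intros m' Hm' Hr'. apply Hn. eapply reach_mono; [|exact Hr']. lia. }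
      exists (S m). repeat split; auto.
      assert (length l <= length (seq 0 n)) as Hle.
      { apply NoDup_incl_length; auto. intros z Hin. apply in_seq. destruct (Hz z Hin). lia. }
      rewrite length_seq in Hle. lia.
Qed.

End Reach.

(** * Heavy vertices and the covering inequality *)

Section Cover.
Variables (n k : nat) (E H : nat -> nat -> bool) (D : nat -> nat -> nat) (Del : nat).

(** Only comparisons with thresholds up to [k] are constrained, so any value above [k] may stand for
    a distance that is too large or infinite. *)
Definition dist_spec : Prop :=
  forall u v m, u < n -> v < n -> m <= k -> (D u v <= m <-> reach_le n E m u v).

Definition cov (w u v : nat) : bool := D u w + D w v <=? k.

Definition heavy (w : nat) : bool := Del <? length (outs n H w).
Definition heavies : list nat := filter heavy (seq 0 n).

(** End vertices, with repetition, of walks in [H] that leave only light vertices: expansion stops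
    at a heavy vertex, so branching is at most [Del]. *)
Fixpoint light_reach (m u : nat) : list nat :=
  match m with
  | 0 => [u]
  | S m' => u :: if heavy u then [] else flat_map (light_reach m') (outs n H u)
  end.

(** The geometric sum [1 + Del + ... + Del ^ m]. *)
Fixpoint geom (m : nat) : nat := match m with 0 => 1 | S m' => 1 + Del * geom m' end.

Lemma length_flat_map_le {A B} (f : A -> list B) c l :
  (forall x, In x l -> length (f x) <= c) -> length (flat_map f l) <= length l * c.
Proof.
  induction l as [|x l IH]; intros Hf; cbn; [lia|]. rewrite length_app.
  specialize (Hf x) as Hx. cbn in Hx. assert (length (f x) <= c) by auto.
  assert (length (flat_map f l) <= length l * c) by (apply IH; intros; apply Hf; now right). lia.
Qed.

Lemma length_light_reach m : forall u, length (light_reach m u) <= geom m.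
Proof.
  induction m as [|m IH]; intros u; cbn [light_reach geom]; [cbn; lia|].
  unfold heavy. destruct (Nat.ltb_spec Del (length (outs n H u))) as [L|L]; cbn; [lia|].
  assert (length (flat_map (light_reach m) (outs n H u)) <= length (outs n H u) * geom m)
    by (apply length_flat_map_le; auto).
  nia.
Qed.

(** Split the walk at the first heavy vertex that it leaves. A heavy end vertex needs no split,
    since [light_reach] records a vertex before testing it. *)
Lemma reach_light_or_heavy m : forall u v, u < n -> reach_le n H m u v ->
  In v (light_reach m u) \/
  exists w a b, In w heavies /\ a + b <= m /\ reach_le n H a u w /\ reach_le n H b w v.
Proof.
  induction m as [|m IH]; intros u v Hu Hr.
  - cbn in Hr. subst. left. now left.
  - destruct Hr as [->|(w & Hw & He & Hr)]; [left; now left|].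
    destruct (heavy u) eqn:Hh.
    + right. exists u, 0, (S m). split; [apply filter_In; split; auto; apply in_seq; lia|].
      split; [lia|]. split; [apply reach_refl|]. right. exists w. auto.
    + destruct (IH w v Hw Hr) as [Hin|(x & a & b & Hx & Hab & Ha & Hb)].
      * left. cbn [light_reach]. rewrite Hh. right. apply in_flat_map. exists w. split; auto.
        apply filter_In. split; auto. apply in_seq. lia.
      * right. exists x, (S a), b. repeat split; auto; [lia|]. right. exists w. auto.
Qed.

Lemma heavies_bound : length heavies * (Del + 1) <= num_edges n H.
Proof.
  rewrite num_edges_list_sum. unfold heavies.
  induction (seq 0 n) as [|u l IH]; cbn [filter map]; [cbn; lia|].
  rewrite list_sum_cons.
  unfold heavy at 1. destruct (Nat.ltb_spec Del (length (outs n H u))); cbn [length]; lia.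
Qed.

(** Each remaining edge has a walk in [H], nonempty because it is not a loop. Its first edge is
    split off: if the rest is light, the pair is charged to that edge, one of [num_edges n H], and
    to one of [geom (k - 1)] ends; otherwise a heavy vertex on the rest covers the pair, and covers
    at most [g] pairs. Distances are those of [E], which are at most those of [H]. *)
Lemma spanner_coverage Rem g : is_spanner n k E H -> dist_spec ->
  (forall i j, i < n -> j < n -> Rem i j = true -> E i j = true /\ i <> j) ->
  (forall w, w < n -> num_edges n (fun i j => Rem i j && cov w i j) <= g) ->
  num_edges n Rem <= num_edges n H * geom (k - 1) + length heavies * g.
Proof.
  intros HH HD HR Hg.
  set (L := flat_map (fun u => map (pair u) (flat_map (light_reach (k - 1)) (outs n H u))) (seq 0 n)).
  set (W := flat_map (fun w => edges n (fun i j => Rem i j && cov w i j)) heavies).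
  assert (HL : length L <= num_edges n H * geom (k - 1)).
  { unfold L. clear L W. rewrite num_edges_list_sum. induction (seq 0 n) as [|u l IH]; cbn [flat_map map]; [cbn; lia|].
    rewrite list_sum_cons.
    rewrite length_app, length_map.
    assert (length (flat_map (light_reach (k - 1)) (outs n H u)) <= length (outs n H u) * geom (k - 1))
      by (apply length_flat_map_le; intros; apply length_light_reach).
    lia. }
  assert (HW : length W <= length heavies * g).
  { apply length_flat_map_le. intros w Hw. apply filter_In in Hw. destruct Hw as [Hw _].
    apply in_seq in Hw. apply Hg. lia. }
  enough (num_edges n Rem <= length (L ++ W)) by (rewrite length_app in *; lia).
  apply num_edges_incl. intros u v Hu Hv Hr.
  destruct (HR u v Hu Hv Hr) as [He Hne].
  destruct HH as [Hsub Hsp]. specialize (Hsp u v Hu Hv He).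
  destruct (reach_step _ _ _ _ _ Hne Hsp) as (w & Hw & Huw & Hwv).
  assert (Hk : 1 <= k) by (destruct (Nat.eq_dec k 0) as [Ek|]; [now rewrite Ek in Hsp|lia]).
  apply in_or_app.
  destruct (reach_light_or_heavy (k - 1) w v Hw Hwv) as [Hin|(x & a & b & Hx & Hab & Ha & Hb)].
  - left. apply in_flat_map. exists u. split; [apply in_seq; lia|]. apply in_map.
    apply in_flat_map. exists w. split; auto. apply filter_In. split; auto. apply in_seq. lia.
  - right. apply in_flat_map. exists x. split; auto. apply in_edges. repeat split; auto.
    rewrite Hr. cbn. apply Nat.leb_le.
    assert (x < n) by (apply filter_In in Hx; destruct Hx as [Hx _]; apply in_seq in Hx; lia).
    (* The first edge from [u] to [w] is put back, and [S a + b <= k] because the rest has length at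
       most [k - 1]. *)
    assert (D u x <= S a).
    { apply HD; auto; [lia|]. apply reach_sub with (H := H); auto. right. exists w. auto. }
    assert (D x v <= b).
    { apply HD; auto; [lia|]. apply reach_sub with (H := H); auto. }
    lia.
Qed.

(** The tail of every non-loop edge has an out-edge in [H], and at most [n] edges share a tail. *)
Lemma nonloop_bound Rem : is_spanner n k E H ->
  (forall i j, i < n -> j < n -> Rem i j = true -> E i j = true /\ i <> j) ->
  num_edges n Rem <= num_edges n H * n.
Proof.
  intros HH HR. transitivity (length (flat_map (fun p => map (pair (fst p)) (seq 0 n)) (edges n H))).
  - apply num_edges_incl. intros u v Hu Hv Hr.
    destruct (HR u v Hu Hv Hr) as [He Hne].
    destruct HH as [Hsub Hsp]. specialize (Hsp u v Hu Hv He).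
    destruct (reach_step _ _ _ _ _ Hne Hsp) as (w & Hw & Huw & _).
    apply in_flat_map. exists (u, w). split; [apply in_edges; auto|]. apply in_map, in_seq. lia.
  - apply length_flat_map_le. intros. now rewrite length_map, length_seq.
Qed.

End Cover.

(** * Decay of the greedy cover and the approximation ratio *)

Section Ratio.
Local Open Scope R_scope.

(** [R i] edges remain and [c i] have been paid after [i] rounds. The best gain is at least
    [(R i - L) / h], so each choice shrinks the excess over [L] by the factor [1 - / INR h], and [T]
    choices leave an excess of at most 1. Further choices gain at least the [2 n] they cost. If the
    choices stop earlier, [g < 2 * n] leaves at most [L + 2 * n * h] edges. *)
Lemma greedy_decay (n L h : nat) (R c : nat -> nat) :
  (1 <= n)%nat -> (1 <= h)%nat -> (R 0 <= n * n)%nat -> c 0%nat = 0%nat ->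
  (forall i, (i < n)%nat -> exists g, (R i <= L + h * g)%nat /\
     (((g < 2 * n)%nat /\ R (S i) = R i /\ c (S i) = c i) \/
      ((2 * n <= g)%nat /\ (R (S i) + g = R i)%nat /\ (c (S i) <= c i + 2 * n)%nat))) ->
  forall T, INR (n * n) * (1 - / INR h) ^ T <= 1 ->
  (c n + R n <= 2 * n * T + L + 2 * n * h + 1)%nat.
Proof.
  intros Hn Hh HR0 Hc0 Hstep T HT.
  set (q := 1 - / INR h) in *.
  assert (Hh' : 1 <= INR h) by (change 1 with (INR 1); now apply le_INR).
  assert (Hq0 : 0 <= q).
  { unfold q. assert (/ INR h <= / 1) by (apply Rinv_le_contravar; lra). lra. }
  (* [t] counts choices. On the left at most [T] were made, and either some round fell below the
     threshold or all [i] rounds removed [2 n] edges each, which is impossible at [i = n]. On the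
     right there were more than [T]. *)
  assert (Hinv : forall i, (i <= n)%nat ->
    (exists t, (t <= T)%nat /\ (c i <= 2 * n * t)%nat /\ INR (R i) - INR L <= INR (n * n) * q ^ t /\
       ((R i <= L + 2 * n * h)%nat \/ (R i + 2 * n * i <= n * n)%nat)) \/
    (c i + R i <= 2 * n * T + L + 1)%nat).
  { induction i as [|i IH]; intros Hi.
    - left. exists 0%nat. split; [lia|]. split; [lia|]. split; [|right; lia].
      cbn. pose proof (pos_INR L). apply le_INR in HR0. lra.
    - destruct (Hstep i) as (g & Hg & Hcase); [lia|].
      destruct IH as [(t & Ht & Hct & HRt & Hst)|IH]; [lia| |].
      2: { right. destruct Hcase as [(_ & -> & ->)|(Hg2 & E1 & E2)]; lia. }
      destruct Hcase as [(Hg2 & -> & ->)|(Hg2 & E1 & E2)].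
      + left. exists t. repeat split; auto. left. nia.
      + destruct (Nat.eq_dec t T) as [->|Hne].
        * right. assert (R i <= L + 1)%nat; [|lia].
          apply INR_le. rewrite plus_INR. cbn [INR]. lra.
        * left. exists (S t). split; [lia|]. split; [nia|]. split; [|destruct Hst; [left|right]; nia].
          rewrite <- E1 in HRt, Hg. apply le_INR in Hg. rewrite plus_INR in HRt. rewrite !plus_INR, mult_INR in Hg.
          cbn [pow].
          assert (Hg' : (INR (R (S i)) + INR g - INR L) * / INR h <= INR g).
          { apply Rmult_le_reg_r with (INR h); [lra|]. rewrite Rmult_assoc, Rinv_l by lra. lra. }
          assert (INR (R (S i)) - INR L <= q * (INR (R (S i)) + INR g - INR L)) by (unfold q; lra).
          assert (q * (INR (R (S i)) + INR g - INR L) <= q * (INR (n * n) * q ^ t))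
            by (apply Rmult_le_compat_l; lra).
          lra. }
  destruct (Hinv n (le_n _)) as [(t & Ht & Hct & _ & [Hst|Hst])|Hi]; [nia|nia|lia].
Qed.

Lemma ln_le x y : 0 < x -> x <= y -> ln x <= ln y.
Proof. intros Hx [H| ->]; [left; now apply ln_increasing|lra]. Qed.

Lemma ln_le_sub x : 0 < x -> ln x <= x - 1.
Proof.
  intros Hx. rewrite <- (ln_exp (x - 1)). apply ln_le; auto.
  pose proof (exp_ineq1_le (x - 1)). lra.
Qed.

Lemma exp_le x y : x <= y -> exp x <= exp y.
Proof. intros [H| ->]; [left; now apply exp_increasing|lra]. Qed.

Lemma exp_pow y T : exp y ^ T = exp (INR T * y).
Proof.
  induction T as [|T IH]; [cbn; now rewrite Rmult_0_l, exp_0|].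
  cbn [pow]. rewrite IH, <- exp_plus, S_INR. f_equal. lra.
Qed.

(** [1 - 1 / h <= exp (- 1 / h)], so [2 h ln n] factors bring [n * n] down to 1; the final [+ 1]
    pays for rounding up. *)
Lemma decay_time (n h : nat) : (1 <= n)%nat -> (1 <= h)%nat ->
  exists T, INR (n * n) * (1 - / INR h) ^ T <= 1 /\ INR T <= 2 * INR h * ln (INR n) + 1.
Proof.
  intros Hn Hh.
  assert (Hn' : 1 <= INR n) by (change 1 with (INR 1); now apply le_INR).
  assert (Hh' : 1 <= INR h) by (change 1 with (INR 1); now apply le_INR).
  assert (Hln : 0 <= ln (INR n)) by (rewrite <- ln_1; apply ln_le; lra).
  set (x := 2 * INR h * ln (INR n)). assert (Hx : 0 <= x) by (unfold x; nra).
  destruct (archimed x) as [A1 A2].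
  assert (Hup : (0 <= up x)%Z) by (apply le_IZR; lra).
  assert (HTe : INR (Z.to_nat (up x)) = IZR (up x)) by now rewrite INR_IZR_INZ, Z2Nat.id.
  exists (Z.to_nat (up x)). split; [|lra].
  set (T := Z.to_nat (up x)).
  assert (HT : x <= INR T) by (unfold T; lra).
  assert (Hinv : 0 < / INR h) by (apply Rinv_0_lt_compat; lra).
  assert (Hq : 0 <= 1 - / INR h).
  { assert (/ INR h <= / 1) by (apply Rinv_le_contravar; lra). lra. }
  assert (H1 : (1 - / INR h) ^ T <= exp (- / INR h) ^ T).
  { apply pow_incr. split; auto. pose proof (exp_ineq1_le (- / INR h)). lra. }
  rewrite exp_pow in H1.
  assert (H2 : exp (INR T * - / INR h) <= exp (- (2 * ln (INR n)))).
  { apply exp_le. assert (x * / INR h <= INR T * / INR h) by (apply Rmult_le_compat_r; lra).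
    assert (x * / INR h = 2 * ln (INR n)) by (unfold x; field; lra). lra. }
  assert (H3 : INR (n * n) = exp (2 * ln (INR n))).
  { rewrite mult_INR. replace (2 * ln (INR n)) with (ln (INR n) + ln (INR n)) by lra.
    now rewrite exp_plus, exp_ln by lra. }
  rewrite H3 in *. set (y := 2 * ln (INR n)) in *.
  assert (H4 : exp y * exp (- y) = 1) by (rewrite <- exp_plus; replace (y + - y) with 0 by lra; apply exp_0).
  pose proof (exp_pos y). nra.
Qed.

(** The extra 1 on the left carries the induction: multiplied by [Del >= 2] it absorbs the new unit
    term. *)
Lemma geom_bound (Del m : nat) : (2 <= Del)%nat -> (geom Del m + 1 <= 2 * Del ^ m)%nat.
Proof. intros HD. induction m as [|m IH]; cbn [geom Nat.pow]; nia. Qed.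

Lemma nat_floor x : 0 <= x -> exists d, INR d <= x < INR d + 1.
Proof.
  intros Hx. destruct (archimed x) as [A1 A2].
  assert (0 < up x)%Z by (apply lt_IZR; lra).
  exists (Z.to_nat (up x - 1)). rewrite INR_IZR_INZ, Z2Nat.id, minus_IZR by lia. lra.
Qed.

Lemma one_le_ln x : 3 <= x -> 1 <= ln x.
Proof. intros Hx. rewrite <- (ln_exp 1). apply ln_le; [apply exp_pos|]. pose proof exp_le_3. lra. Qed.

Lemma ratio_pos n k : 0 < ratio n k.
Proof. apply exp_pos. Qed.

(* For [k] so large that [(n log n) ^ (1 / k) < 2], the ratio is of order [n log n] already. *)
Lemma ratio_ge_n n k : (2 <= n)%nat -> (2 < k)%nat -> Rpower (INR n * ln (INR n)) (/ INR k) < 2 ->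
  INR n <= 2 * ratio n k.
Proof.
  intros Hn Hk HD.
  assert (Hk' : 3 <= INR k) by (replace 3 with (INR 3) by (cbn; lra); now apply le_INR).
  assert (Hkinv : / INR k <= / 3) by (apply Rinv_le_contravar; lra).
  assert (Hkpos : 0 < / INR k) by (apply Rinv_0_lt_compat; lra).
  set (N := INR n * ln (INR n)) in *.
  destruct (Nat.eq_dec n 2) as [->|Hne].
  - assert (1 <= N).
    { unfold N. replace (INR 2) with 2 by (cbn; lra). pose proof ln_lt_2. lra. }
    assert (1 <= ratio 2 k).
    { apply Rle_trans with (Rpower N 0); [rewrite Rpower_O; lra|].
      unfold ratio. fold N. apply Rle_Rpower; unfold Rdiv; lra. }
    replace (INR 2) with 2 by (cbn; lra). lra.
  - assert (Hn3 : 3 <= INR n) by (replace 3 with (INR 3) by (cbn; lra); apply le_INR; lia).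
    pose proof (one_le_ln _ Hn3) as Hln.
    assert (HN : INR n <= N) by (unfold N; nra).
    assert (N = ratio n k * Rpower N (/ INR k)).
    { unfold ratio. fold N. rewrite <- Rpower_plus. replace (1 - 1 / INR k + / INR k) with 1 by (unfold Rdiv; lra).
      rewrite Rpower_1; lra. }
    pose proof (ratio_pos n k). nra.
Qed.

(* [h] vertices of out-degree at least [Del + 1 > x] and the [Del ^ (k - 1)]-bound on light
   pairs balance at [x = (n log n) ^ (1 / k)]. *)
Lemma balance (n k opt h L c : nat) x T : (2 < k)%nat ->
  x = Rpower (INR n * ln (INR n)) (/ INR k) -> 2 <= x ->
  forall Del, INR Del <= x < INR Del + 1 ->
  (1 <= n)%nat -> (h * (Del + 1) <= opt)%nat -> (L <= opt * geom Del (k - 1))%nat -> (1 <= opt)%nat ->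
  (c <= L)%nat \/ ((1 <= h)%nat /\ INR T <= 2 * INR h * ln (INR n) + 1 /\
    (c <= 2 * n * T + L + 2 * n * h + 1)%nat) -> INR c <= 11 * ratio n k * INR opt.
Proof.
  intros Hk Hx Hx2 Del HDel Hn Hh HL HO Hc.
  assert (Hk' : 3 <= INR k) by (replace 3 with (INR 3) by (cbn; lra); now apply le_INR).
  assert (Hkinv : / INR k <= / 3) by (apply Rinv_le_contravar; lra).
  assert (Hkpos : 0 < / INR k) by (apply Rinv_0_lt_compat; lra).
  set (N := INR n * ln (INR n)) in *.
  assert (Hn1 : 1 <= INR n) by (change 1 with (INR 1); now apply le_INR).
  assert (HN1 : 1 < N).
  { destruct (Rlt_le_dec 1 N) as [|Hle]; [auto|exfalso].
    assert (x <= 1); [|lra]. rewrite Hx.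
    destruct (Rlt_le_dec 0 N) as [Hpos|Hneg].
    - unfold Rpower. rewrite <- exp_0. apply exp_le.
      assert (ln N <= 0) by (rewrite <- ln_1; apply ln_le; lra). nra.
    (* [ln] takes the default value 0 on nonpositive numbers, so [Rpower] is 1 there, still below
       2. *)
    - assert (ln N = 0) as Hl0 by (unfold ln; destruct (Rlt_dec 0 N); [exfalso; lra|reflexivity]).
      unfold Rpower. rewrite Hl0, Rmult_0_r, exp_0. lra. }
  assert (Hln0 : 0 <= ln (INR n)) by (rewrite <- ln_1; apply ln_le; lra).
  assert (HxN : Rpower x (INR k) = N).
  { rewrite Hx, Rpower_mult, Rinv_l by lra. apply Rpower_1. lra. }
  assert (HxleN : x <= N).
  { rewrite Hx. rewrite <- (Rpower_1 N) at 2 by lra. apply Rle_Rpower; lra. }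
  (* For [n <= 2] one would have [n ln n <= 2 ln 2 < 2], against [2 <= x <= N]. *)
  assert (Hn3 : (3 <= n)%nat).
  { destruct (Nat.lt_ge_cases n 3) as [Hlt|]; [exfalso|auto].
    assert (INR n <= 2) by (replace 2 with (INR 2) by (cbn; lra); apply le_INR; lia).
    pose proof (ln_le_sub (INR n) ltac:(lra)). unfold N in *.
    assert (INR n * ln (INR n) <= 2 * 1) by nra.
    assert (ln 2 < 1).
    { rewrite <- (ln_exp 1). apply ln_increasing; [lra|]. pose proof (exp_ineq1 1). lra. }
    assert (ln (INR n) <= ln 2) by (apply ln_le; lra).
    nra. }
  assert (Hn3' : 3 <= INR n) by (replace 3 with (INR 3) by (cbn; lra); now apply le_INR).
  pose proof (one_le_ln _ Hn3') as Hln.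
  assert (Hratio : N = ratio n k * x).
  { unfold ratio. fold N. rewrite Hx, <- Rpower_plus.
    replace (1 - 1 / INR k + / INR k) with 1 by (unfold Rdiv; lra). rewrite Rpower_1; lra. }
  assert (Hratio' : x ^ (k - 1) = ratio n k).
  { unfold ratio. fold N. rewrite <- Rpower_pow by lra. rewrite Hx, Rpower_mult. f_equal.
    rewrite minus_INR by lia. cbn [INR]. field. lra. }
  pose proof (ratio_pos n k) as Hr.
  assert (Hr1 : 1 <= ratio n k) by (rewrite <- Hratio'; apply pow_R1_Rle; lra).
  assert (HO1 : 1 <= INR opt) by (change 1 with (INR 1); now apply le_INR).
  assert (HDel2 : (2 <= Del)%nat).
  { destruct (Nat.lt_ge_cases Del 2) as [Hlt|]; [exfalso|auto].
    assert (INR Del <= 1) by (change 1 with (INR 1); apply le_INR; lia). lra. }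
  assert (HhO : INR h * x <= INR opt).
  { apply le_INR in Hh. rewrite mult_INR, plus_INR in Hh. cbn [INR] in Hh. pose proof (pos_INR h). nra. }
  assert (HhN : N * INR h <= ratio n k * INR opt) by (rewrite Hratio; nra).
  assert (HLO : INR L <= 2 * (ratio n k * INR opt)).
  { assert (HL2 : (L <= opt * (2 * Del ^ (k - 1)))%nat) by (pose proof (geom_bound Del (k - 1) HDel2); nia).
    apply le_INR in HL2. rewrite !mult_INR, pow_INR in HL2. cbn [INR] in HL2.
    assert (INR Del ^ (k - 1) <= ratio n k).
    { rewrite <- Hratio'. apply pow_incr. split; [apply pos_INR|lra]. }
    nra. }
  destruct Hc as [Hc|(Hh1 & HT & Hc)]; apply le_INR in Hc; [nra|].
  assert (Hh1' : 1 <= INR h) by (change 1 with (INR 1); now apply le_INR).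
  rewrite !plus_INR, !mult_INR in Hc. cbn [INR] in Hc.
  (* Write [B] for [ratio n k * INR opt], so that [N * INR h <= B]. The trees cost
     [2 n T <= 4 B + 2 B], and [L], [2 n h] and 1 are at most [2 B], [2 B] and [B]: in total 11. *)
  assert (INR n * INR T <= 2 * (N * INR h) + INR n) by (unfold N; nra).
  assert (INR n <= INR n * INR h) by nra.
  assert (INR n * INR h <= N * INR h) by (unfold N; nra).
  assert (1 <= ratio n k * INR opt) by nra.
  lra.
Qed.

Lemma num_edges_orb n f g :
  (num_edges n (fun i j => f i j || g i j) <= num_edges n f + num_edges n g)%nat.
Proof.
  change (num_edges n f) with (length (edges n f)). change (num_edges n g) with (length (edges n g)).
  rewrite <- length_app. apply num_edges_incl. intros i j Hi Hj Hfg. apply in_or_app.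
  apply orb_true_iff in Hfg. destruct Hfg; [left|right]; apply in_edges; auto.
Qed.

Lemma greedy_ratio n k E H D (Rem : nat -> nat -> nat -> bool) (c : nat -> nat) :
  (1 <= n)%nat -> (2 < k)%nat -> is_spanner n k E H -> dist_spec n k E D -> c 0%nat = 0%nat ->
  (forall t i j, (t <= n)%nat -> (i < n)%nat -> (j < n)%nat -> Rem t i j = true -> E i j = true /\ i <> j) ->
  (forall t, (t < n)%nat -> exists g,
     (forall w, (w < n)%nat -> (num_edges n (fun i j => Rem t i j && cov k D w i j) <= g)%nat) /\
     (((g < 2 * n)%nat /\ num_edges n (Rem (S t)) = num_edges n (Rem t) /\ c (S t) = c t) \/
      ((2 * n <= g)%nat /\ (num_edges n (Rem (S t)) + g = num_edges n (Rem t))%nat /\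
       (c (S t) <= c t + 2 * n)%nat))) ->
  INR (c n + num_edges n (Rem n)) <= 11 * ratio n k * INR (num_edges n H).
Proof.
  intros Hn Hk HH HD Hc0 HR Hstep.
  set (R := fun t => num_edges n (Rem t)). set (opt := num_edges n H).
  (* A choice adds at most [2 n] edges and removes at least as many, so the total never exceeds the
     initial [R 0]. This alone settles the cases of optimum 0, of [n = 1], and of [x < 2]. *)
  assert (Hmon : forall t, (t <= n)%nat -> (c t + R t <= R 0)%nat).
  { induction t as [|t IH]; intros Ht; [lia|]. specialize (IH ltac:(lia)).
    destruct (Hstep t) as (g & _ & [(_ & E1 & E2)|(G & E1 & E2)]); [lia| |]; unfold R in *; lia. }
  specialize (Hmon n (le_n n)). fold (R n).
  assert (HR0 : (R 0 <= opt * n)%nat).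
  { apply (nonloop_bound n k E H); [auto|]. intros i j. apply HR. lia. }
  pose proof (ratio_pos n k) as Hr. pose proof (pos_INR opt) as HO.
  destruct (Nat.eq_dec opt 0) as [HO0|HO0].
  { replace (c n + R n)%nat with 0%nat by (rewrite HO0 in HR0; lia). cbn [INR]. nra. }
  destruct (Nat.eq_dec n 1) as [->|Hn1].
  { assert (R 0 <= length (@nil (nat * nat)))%nat.
    { apply num_edges_incl. intros i j Hi Hj Hb. destruct (HR 0%nat i j) as [_ Hne]; auto. lia. }
    cbn [length] in *. replace (c 1 + R 1)%nat with 0%nat by lia. cbn [INR]. nra. }
  set (x := Rpower (INR n * ln (INR n)) (/ INR k)).
  destruct (Rlt_le_dec x 2) as [Hx|Hx].
  { assert (Hrn : INR n <= 2 * ratio n k) by (apply ratio_ge_n; auto; lia).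
    assert (Hle : (c n + R n <= opt * n)%nat) by lia. apply le_INR in Hle. rewrite mult_INR in Hle. nra. }
  destruct (nat_floor x ltac:(lra)) as [Del HDel].
  set (h := length (heavies n H Del)). set (L := (opt * geom Del (k - 1))%nat).
  assert (Hcover : forall t g, (t <= n)%nat ->
     (forall w, (w < n)%nat -> (num_edges n (fun i j => Rem t i j && cov k D w i j) <= g)%nat) ->
     (R t <= L + h * g)%nat).
  { intros t g Ht Hg. apply (spanner_coverage n k E H D Del); auto.
    intros i j. now apply HR. }
  assert (Hh : (h * (Del + 1) <= opt)%nat) by apply heavies_bound.
  destruct (Nat.eq_dec h 0) as [Hh0|Hh0].
  - apply (balance n k opt h L _ x 0) with (Del := Del); auto; [lia|left].
    (* Without heavy vertices the gain is multiplied by 0, so the trivial bound [n * n] on it will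
       do. *)
    specialize (Hcover 0%nat (n * n)%nat). rewrite Hh0 in Hcover.
    assert (R 0 <= L + 0 * (n * n))%nat; [|lia].
    apply Hcover; [lia|]. intros w _. apply num_edges_le_square.
  - destruct (decay_time n h) as (T & HT1 & HT2); [auto|lia|].
    apply (balance n k opt h L _ x T) with (Del := Del); auto; [lia|right]. split; [lia|]. split; [auto|].
    apply (greedy_decay n L h R c); auto; [lia|apply num_edges_le_square|].
    intros t Ht. destruct (Hstep t Ht) as (g & Hg & Hcase). exists g. split; [|exact Hcase].
    apply Hcover; auto. lia.
Qed.

End Ratio.

(** * Loop programs *)

(** Syntactic write sets; frame conditions on concrete programs then hold by computation. *)
Fixpoint mod_var (c : cmd) (x : nat) : bool :=
  match c with
  | CSet y _ | CRead y _ => x =? y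
  | CSeq c1 c2 | CIf _ c1 c2 => mod_var c1 x || mod_var c2 x
  | CFor y c => (x =? y) || mod_var c x
  | _ => false
  end.

Fixpoint mod_arr (c : cmd) (a : nat) : bool :=
  match c with
  | CPut b _ _ => a =? b
  | CSeq c1 c2 | CIf _ c1 c2 => mod_arr c1 a || mod_arr c2 a
  | CFor _ c => mod_arr c a
  | _ => false
  end.

Fixpoint mod_raw (c : cmd) : bool :=
  match c with
  | CWrite _ _ => true
  | CSeq c1 c2 | CIf _ c1 c2 => mod_raw c1 || mod_raw c2
  | CFor _ c => mod_raw c
  | _ => false
  end.

(** * Frame rules and loop invariants *)

Section Frames.
Variables (NR n k : nat).
Notation run := (run_cmd NR n k).

Definition iter_for (x : nat) (c : cmd) (s : st) (j : nat) : st :=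
  nat_rect (fun _ => st) s (fun j s' => run c (setv s' x j)) j.

Lemma run_for x c s : run (CFor x c) s = iter_for x c s n.
Proof. reflexivity. Qed.

Lemma iter_for_S x c s j : iter_for x c s (S j) = run c (setv (iter_for x c s j) x j).
Proof. reflexivity. Qed.

Lemma run_vr c y : mod_var c y = false -> forall s, vr (run c s) y = vr s y.
Proof.
  induction c; cbn [mod_var run_cmd]; intros Hm s; rewrite ?orb_false_iff in Hm; try reflexivity.
  - cbn. now rewrite Hm.
  - cbv zeta. destruct (in_raw _ _ _); [|reflexivity]. cbn. now rewrite Hm.
  - cbv zeta. destruct (in_raw _ _ _); reflexivity.
  - destruct Hm. now rewrite IHc2, IHc1.
  - destruct Hm. destruct (_ =? 0); auto.
  (* [n] is also a parameter of the semantics; only its occurrence as the number of passes is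
     generalised. *)
  - destruct Hm as [H1 H2]. induction n as [|m IH] at 2; cbn [nat_rect]; [reflexivity|].
    rewrite IHc by auto. cbn. rewrite H1. exact IH.
Qed.

Lemma run_ar c a : mod_arr c a = false -> forall s, ar (run c s) a = ar s a.
Proof.
  induction c; cbn [mod_arr run_cmd]; intros Hm s; rewrite ?orb_false_iff in Hm; try reflexivity.
  - cbn. now rewrite Hm.
  - cbv zeta. destruct (in_raw _ _ _); reflexivity.
  - cbv zeta. destruct (in_raw _ _ _); reflexivity.
  - destruct Hm. now rewrite IHc2, IHc1.
  - destruct Hm. destruct (_ =? 0); auto.
  - induction n as [|m IH] at 2; cbn [nat_rect]; [reflexivity|].
    rewrite IHc by auto. exact IH.
Qed.

Lemma run_rw c : mod_raw c = false -> forall s, rw (run c s) = rw s.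
Proof.
  induction c; cbn [mod_raw run_cmd]; intros Hm s; rewrite ?orb_false_iff in Hm; try reflexivity.
  - cbv zeta. destruct (in_raw _ _ _); reflexivity.
  - discriminate.
  - destruct Hm. now rewrite IHc2, IHc1.
  - destruct Hm. destruct (_ =? 0); auto.
  - induction n as [|m IH] at 2; cbn [nat_rect]; [reflexivity|].
    rewrite IHc by auto. exact IH.
Qed.

(** The step may also assume that whatever the body does not write still has its value from before
    the loop, so an invariant need mention only what changes. *)
Lemma for_inv x c (I : nat -> st -> Prop) s :
  I 0 s ->
  (forall j s', j < n ->
     (forall y, mod_var (CFor x c) y = false -> vr s' y = vr s y) ->
     (forall a, mod_arr c a = false -> ar s' a = ar s a) ->
     (mod_raw c = false -> rw s' = rw s) ->
     I j s' -> I (S j) (run c (setv s' x j))) ->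
  I n (run (CFor x c) s).
Proof.
  intros H0 HS. rewrite run_for.
  enough (G : forall j, j <= n -> I j (iter_for x c s j) /\
     (forall y, mod_var (CFor x c) y = false -> vr (iter_for x c s j) y = vr s y) /\
     (forall a, mod_arr c a = false -> ar (iter_for x c s j) a = ar s a) /\
     (mod_raw c = false -> rw (iter_for x c s j) = rw s)) by (apply G; lia).
  induction j as [|j IH]; intros Hj; [cbn; auto|].
  destruct IH as (IH1 & IH2 & IH3 & IH4); [lia|]. rewrite iter_for_S. split; [|split; [|split]].
  - apply HS; auto.
  - intros y Hy. assert (Hy' := Hy). cbn in Hy'. apply orb_false_iff in Hy'. destruct Hy' as [Hy1 Hy2].
    rewrite run_vr by auto. cbn. rewrite Hy1. auto.
  - intros a Ha. rewrite run_ar by auto. cbn. auto.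
  - intros Hr. rewrite run_rw by auto. cbn. auto.
Qed.

Definition cell (f : nat -> nat) (i j : nat) : nat := f (i * n + j).

Lemma cell_upd f i j v i' j' : j < n -> j' < n ->
  cell (upd f (i * n + j) v) i' j' = if (i' =? i) && (j' =? j) then v else cell f i' j'.
Proof.
  intros Hj Hj'. unfold cell, upd.
  destruct (Nat.eqb_spec i' i) as [->|Hi]; cbn [andb].
  - destruct (Nat.eqb_spec j' j) as [->|Hn]; [now rewrite Nat.eqb_refl|].
    destruct (Nat.eqb_spec (i * n + j') (i * n + j)); [lia|reflexivity].
  - destruct (Nat.eqb_spec (i' * n + j') (i * n + j)) as [Heq|]; [|reflexivity].
    exfalso. apply Hi. destruct (Nat.div_mod_unique n i' i j' j); auto. lia.
Qed.

(** For sweeps treating matrix cells in isolation: pass [(i, j)] alters only its own cell, so each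
    cell is transformed once, from its original value. *)
Lemma for2_map xi xj c a (F : nat -> nat -> nat -> nat) s :
  mod_var c xi = false -> xi <> xj ->
  (forall i j s', i < n -> j < n ->
     (forall y, mod_var (CFor xi (CFor xj c)) y = false -> vr s' y = vr s y) ->
     (forall b, mod_arr c b = false -> ar s' b = ar s b) ->
     (mod_raw c = false -> rw s' = rw s) ->
     vr s' xi = i -> vr s' xj = j ->
     forall i' j', i' < n -> j' < n ->
     cell (ar (run c s') a) i' j' =
       if (i' =? i) && (j' =? j) then F i j (cell (ar s' a) i j) else cell (ar s' a) i' j') ->
  forall i j, i < n -> j < n ->
    cell (ar (run (CFor xi (CFor xj c)) s) a) i j = F i j (cell (ar s a) i j).
Proof.
  intros Hxi Hne Hb.
  set (I := fun (i : nat) (s' : st) => forall i' j', i' < n -> j' < n ->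
     cell (ar s' a) i' j' = if i' <? i then F i' j' (cell (ar s a) i' j') else cell (ar s a) i' j').
  assert (HI : I n (run (CFor xi (CFor xj c)) s)).
  { apply for_inv; [intros i' j' _ _; reflexivity|].
    intros i s1 Hi Hv1 Ha1 Hr1 HI1.
    assert (Hin : forall i' j', i' < n -> j' < n ->
      cell (ar (run (CFor xj c) (setv s1 xi i)) a) i' j' =
      if (i' =? i) && (j' <? n) then F i' j' (cell (ar s1 a) i' j') else cell (ar s1 a) i' j').
    { apply (for_inv xj c (fun j s' => forall i' j', i' < n -> j' < n ->
        cell (ar s' a) i' j' =
        if (i' =? i) && (j' <? j) then F i' j' (cell (ar s1 a) i' j') else cell (ar s1 a) i' j')).
      - intros i' j' _ _. now rewrite andb_false_r.
      - intros j s2 Hj Hv2 Ha2 Hr2 HI2 i' j' Hi' Hj'.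
        rewrite (Hb i j (setv s2 xj j)); auto.
        + cbn [setv ar]. rewrite !HI2 by auto. rewrite Nat.eqb_refl, Nat.ltb_irrefl. cbn [andb].
          destruct (Nat.eqb_spec i' i) as [->|]; cbn [andb]; [|reflexivity].
          destruct (Nat.eqb_spec j' j) as [->|].
          * destruct (Nat.ltb_spec j (S j)); [reflexivity|lia].
          * destruct (Nat.ltb_spec j' j), (Nat.ltb_spec j' (S j)); try lia; reflexivity.
        + intros y Hy. assert (Hy' := Hy). cbn [mod_var] in Hy'. rewrite !orb_false_iff in Hy'.
          destruct Hy' as (Y1 & Y2 & Y3). cbn [setv vr]. rewrite Y2, Hv2 by (cbn [mod_var]; now rewrite Y2, Y3).
          cbn [setv vr]. rewrite Y1. auto.
        + intros b Hb'. cbn [setv ar]. rewrite Ha2 by auto. cbn [setv ar]. auto.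
        + intros Hr. cbn [setv rw]. rewrite Hr2 by auto. cbn [setv rw]. auto.
        + cbn [setv vr]. apply Nat.eqb_neq in Hne. rewrite Hne, Hv2 by (cbn [mod_var]; now rewrite Hne, Hxi).
          cbn [setv vr]. now rewrite Nat.eqb_refl.
        + cbn [setv vr]. now rewrite Nat.eqb_refl. }
    intros i' j' Hi' Hj'. rewrite Hin by auto. rewrite !HI1 by auto.
    replace (j' <? n) with true by (symmetry; now apply Nat.ltb_lt). rewrite andb_true_r.
    destruct (Nat.eqb_spec i' i) as [->|].
    - rewrite Nat.ltb_irrefl. destruct (Nat.ltb_spec i (S i)); [reflexivity|lia].
    - destruct (Nat.ltb_spec i' i), (Nat.ltb_spec i' (S i)); try lia; reflexivity. }
  intros i j Hi Hj. rewrite HI by auto. apply Nat.ltb_lt in Hi. now rewrite Hi.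
Qed.

End Frames.

(** * The algorithm *)

Definition NVARS : nat := 11.
Definition NARRS : nat := 5.
(** The 5 fixed registers, the 11 variables and 16 scratch registers. *)
Definition NREGS : nat := 32.

(* Arrays: 0 adjacency matrix, 1 row offsets [i * n], 2 distances (capped at [k + 1]), 3 spanner,
   4 edges not yet spanned.
   Variables: 0 packed input bits, 1-3 vertices, 4 round, 5 candidate root, 6 its gain, 7 and 8 best
   gain and root, 9 result of a search shifted by 1 (0 if it failed), 10 scratch. *)
Definition ix (i j : nat) : expr := EAdd (EArr 1 (EV i)) (EV j).
Definition for_for (i j : nat) (c : cmd) : cmd := CFor i (CFor j c).

(** The truncated difference is nonzero exactly when the packed value is at least [2 ^ r'], that is,
    when its leading bit is 1. All powers of two are constants of the program. *)
Fixpoint unpack (i r : nat) : cmd :=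
  match r with
  | 0 => CSkip
  | S r' =>
      CSeq (CIf (ESub (EAdd (EV 0) (EC 1)) (EC (2 ^ r')))
              (CSeq (CPut 0 (EC (i - 2)) (EC 1)) (CSet 0 (ESub (EV 0) (EC (2 ^ r')))))
              (CPut 0 (EC (i - 2)) (EC 0)))
           (unpack (S i) r')
  end.

Definition row_loop : cmd := CFor 1 (CSeq (CPut 1 (EV 1) (EV 10)) (CSet 10 (EAdd (EV 10) EN))).
(** Cells below [NREGS] now serve as registers; their bits are in array 0 already, so they are
    skipped. *)
Definition read_input : cmd :=
  for_for 1 2 (CSeq (CSet 10 (EAdd (ix 1 2) (EC 2)))
    (CIf (ESub (EAdd (EV 10) (EC 1)) (EC NREGS)) (CSeq (CRead 9 (EV 10)) (CPut 0 (ix 1 2) (EV 9))) CSkip)).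
Definition init_dist : cmd := for_for 1 2 (CPut 2 (ix 1 2) (EAdd EK (EC 1))).
Definition diag (a : nat) : cmd := CFor 1 (CPut a (ix 1 1) (EC 0)).
Definition init_rem : cmd := for_for 1 2 (CPut 4 (ix 1 2) (EArr 0 (ix 1 2))).
Definition init_span : cmd := for_for 1 2 (CPut 3 (ix 1 2) (EC 0)).

(** In-place Bellman-Ford relaxation of the edge from [EV 1] to [EV 3], for all targets [EV 2] at
    once. *)
Definition relax_row : cmd :=
  CFor 2 (CIf (EArr 0 (ix 1 3))
    (CIf (ESub (EArr 2 (ix 1 2)) (EAdd (EArr 2 (ix 3 2)) (EC 1)))
      (CPut 2 (ix 1 2) (EAdd (EArr 2 (ix 3 2)) (EC 1))) CSkip) CSkip).
Definition relax_vertex : cmd := CFor 3 relax_row.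
Definition relax_round : cmd := CFor 1 relax_vertex.
Definition distances : cmd := CFor 4 relax_round.

(** Nonzero exactly when the root [EV 5] spans the pair, again by truncated subtraction. *)
Definition cov_expr : expr := ESub (EAdd EK (EC 1)) (EAdd (EArr 2 (ix 1 5)) (EArr 2 (ix 5 2))).
Definition count_row : cmd :=
  CFor 2 (CIf (EArr 4 (ix 1 2)) (CIf cov_expr (CSet 6 (EAdd (EV 6) (EC 1))) CSkip) CSkip).
Definition count_loop : cmd := CFor 1 count_row.
Definition best_loop : cmd :=
  CFor 5 (CSeq (CSet 6 (EC 0)) (CSeq count_loop
    (CIf (ESub (EV 6) (EV 7)) (CSeq (CSet 7 (EV 6)) (CSet 8 (EV 5))) CSkip))).

Definition neq_expr (e1 e2 : expr) : expr := EAdd (ESub e1 e2) (ESub e2 e1).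
Definition in_search : cmd :=
  CFor 3 (CIf (EArr 0 (ix 1 3))
    (CIf (neq_expr (EAdd (EArr 2 (ix 3 5)) (EC 1)) (EArr 2 (ix 1 5))) CSkip
      (CSet 9 (EAdd (EV 3) (EC 1)))) CSkip).
Definition in_tree : cmd :=
  CFor 1 (CSeq (CSet 9 (EC 0)) (CSeq in_search
    (CIf (EV 9) (CPut 3 (EAdd (EArr 1 (EV 1)) (ESub (EV 9) (EC 1))) (EC 1)) CSkip))).
Definition out_search : cmd :=
  CFor 3 (CIf (EArr 0 (ix 3 1))
    (CIf (neq_expr (EAdd (EArr 2 (ix 5 3)) (EC 1)) (EArr 2 (ix 5 1))) CSkip
      (CSet 9 (EAdd (EV 3) (EC 1)))) CSkip).
Definition out_tree : cmd :=
  CFor 1 (CSeq (CSet 9 (EC 0)) (CSeq out_search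
    (CIf (EV 9) (CPut 3 (EAdd (EArr 1 (ESub (EV 9) (EC 1))) (EV 1)) (EC 1)) CSkip))).
Definition remove : cmd := for_for 1 2 (CIf cov_expr (CPut 4 (ix 1 2) (EC 0)) CSkip).

Definition search_best : cmd := CSeq (CSet 7 (EC 0)) (CSeq (CSet 8 (EC 0)) best_loop).
Definition pick : cmd := CSeq (CSet 5 (EV 8)) (CSeq in_tree (CSeq out_tree remove)).
(** The test is nonzero exactly when the best gain is at least [2 n]. A failing round leaves the
    matrices unchanged, so the loop needs no exit. *)
Definition greedy_step : cmd :=
  CSeq search_best (CIf (ESub (EAdd (EV 7) (EC 1)) (EAdd EN EN)) pick CSkip).
Definition greedy : cmd := CFor 4 greedy_step.
Definition finish : cmd := for_for 1 2 (CIf (EArr 4 (ix 1 2)) (CPut 3 (ix 1 2) (EC 1)) CSkip).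
Definition write_output : cmd := for_for 1 2 (CWrite (EAdd (ix 1 2) (EC 2)) (EArr 3 (ix 1 2))).

Definition prog_init : cmd :=
  CSeq (unpack 2 (NREGS - 2)) (CSeq (CSet 10 (EC 0)) (CSeq row_loop (CSeq read_input
  (CSeq init_dist (CSeq (diag 2) (CSeq init_rem (CSeq (diag 4) (CSeq init_span distances)))))))).
Definition prog : cmd := CSeq prog_init (CSeq greedy (CSeq finish write_output)).

(** * Reading the input and initialising the matrices *)

Section Verify.
Variables (n k : nat).
Notation run := (run_cmd NREGS n k).
Notation cell := (cell n).

Definition bm (f : nat -> nat) (i j : nat) : bool := negb (cell f i j =? 0).
Definition rows (s : st) : Prop := forall i, i < n -> ar s 1 i = i * n.

Ltac sx := cbn [run_cmd eval setv seta setw vr ar rw Nat.eqb ix cov_expr neq_expr].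

Lemma cell_ar s a i j : ar s a (i * n + j) = cell (ar s a) i j.
Proof. reflexivity. Qed.

Lemma unpack_ok m r : (forall i, 2 <= i -> m i <= 1) -> forall i s, 2 <= i -> vr s 0 = bits_val m i r ->
  (forall j, j < r -> ar (run (unpack i r) s) 0 (i - 2 + j) = m (i + j)) /\
  (forall j, j < i - 2 -> ar (run (unpack i r) s) 0 j = ar s 0 j).
Proof.
  intros Hm. induction r as [|r IH]; intros i s Hi Hv.
  - split; [lia|reflexivity].
  - cbn [unpack]. cbn [run_cmd].
    set (s1 := if eval n k (ESub (EAdd (EV 0) (EC 1)) (EC (2 ^ r))) s =? 0 then _ else _).
    cbn [bits_val] in Hv. assert (Hlt : bits_val m (S i) r < 2 ^ r) by (apply bits_val_lt; intros; apply Hm; lia).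
    specialize (Hm i Hi).
    assert (H1 : vr s1 0 = bits_val m (S i) r /\ ar s1 0 = upd (ar s 0) (i - 2) (m i)).
    { unfold s1. cbn [eval].
      destruct (Nat.eqb_spec (vr s 0 + 1 - 2 ^ r) 0) as [E|E].
      - sx. assert (m i = 0) as Hmi by nia. rewrite Hmi in *. split; [lia|reflexivity].
      - sx. assert (m i = 1) as Hmi by nia. rewrite Hmi in *. split; [lia|reflexivity]. }
    destruct H1 as [V1 A1]. destruct (IH (S i) s1 ltac:(lia) V1) as [I1 I2]. split.
    + intros [|j] Hj.
      * rewrite !Nat.add_0_r, I2, A1 by lia. apply upd_same.
      * replace (i - 2 + S j) with (S i - 2 + j) by lia. rewrite I1 by lia. f_equal. lia.
    + intros j Hj. rewrite I2, A1 by lia. apply upd_other. lia.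
Qed.

Lemma row_loop_ok s : vr s 10 = 0 -> rows (run row_loop s).
Proof.
  intros H. unfold row_loop.
  enough (vr (run row_loop s) 10 = n * n /\ forall i, i < n -> ar (run row_loop s) 1 i = i * n) as [_ He] by exact He.
  apply (for_inv NREGS n k 1 _ (fun j s' => vr s' 10 = j * n /\ forall i, i < j -> ar s' 1 i = i * n)).
  - split; [exact H|lia].
  - intros j s' Hj _ _ _ [V A]. sx. split; [lia|]. intros i Hi.
    destruct (Nat.eq_dec i j) as [->|Hne]; [rewrite upd_same; lia|].
    rewrite upd_other by auto. apply A. lia.
Qed.

Lemma read_input_ok s i j : rows s -> i < n -> j < n ->
  cell (ar (run read_input s) 0) i j =
    if NREGS <=? 2 + (i * n + j) then rw s (2 + (i * n + j)) else cell (ar s 0) i j.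
Proof.
  intros Hrow. revert i j. unfold read_input.
  apply (for2_map NREGS n k 1 2 _ 0 (fun i j x => if NREGS <=? 2 + (i * n + j) then rw s (2 + (i * n + j)) else x));
    [reflexivity|discriminate|].
  intros i j s' Hi Hj _ Ha Hr Vi Vj i' j' Hi' Hj'. specialize (Hr eq_refl).
  assert (Hix : ar s' 1 i = i * n) by (rewrite Ha by reflexivity; auto).
  sx. rewrite Vi, Vj, Hix.
  assert (Hlt : i * n + j < n * n) by nia.
  destruct (Nat.leb_spec NREGS (2 + (i * n + j))) as [L|L].
  - replace (i * n + j + 2 + 1 - NREGS =? 0) with false by (symmetry; apply Nat.eqb_neq; lia).
    replace (in_raw NREGS n (i * n + j + 2)) with true.
    2: { symmetry. unfold in_raw, base. rewrite andb_true_iff, Nat.leb_le, Nat.ltb_lt. lia. }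
    sx. rewrite Vi, Vj, Hix, cell_upd, Hr by auto.
    replace (i * n + j + 2) with (2 + (i * n + j)) by lia. reflexivity.
  - replace (i * n + j + 2 + 1 - NREGS =? 0) with true by (symmetry; apply Nat.eqb_eq; lia).
    sx. destruct (Nat.eqb_spec i' i) as [->|]; [|reflexivity].
    destruct (Nat.eqb_spec j' j) as [->|]; reflexivity.
Qed.

Lemma init_dist_ok s i j : rows s -> i < n -> j < n -> cell (ar (run init_dist s) 2) i j = k + 1.
Proof.
  intros Hrow. revert i j. unfold init_dist.
  apply (for2_map NREGS n k 1 2 _ 2 (fun i j x => k + 1)); [reflexivity|discriminate|].
  intros i j s' Hi Hj _ Ha _ Vi Vj i' j' Hi' Hj'.
  assert (Hix : ar s' 1 i = i * n) by (rewrite Ha by reflexivity; auto).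
  sx. rewrite Vi, Vj, Hix. now rewrite cell_upd.
Qed.

Lemma init_rem_ok s i j : rows s -> i < n -> j < n ->
  cell (ar (run init_rem s) 4) i j = cell (ar s 0) i j.
Proof.
  intros Hrow. revert i j. unfold init_rem.
  apply (for2_map NREGS n k 1 2 _ 4 (fun i j x => cell (ar s 0) i j)); [reflexivity|discriminate|].
  intros i j s' Hi Hj _ Ha _ Vi Vj i' j' Hi' Hj'.
  assert (Hix : ar s' 1 i = i * n) by (rewrite Ha by reflexivity; auto).
  assert (H0 : ar s' 0 = ar s 0) by (apply Ha; reflexivity).
  sx. rewrite Vi, Vj, Hix, H0. now rewrite cell_upd.
Qed.

Lemma init_span_ok s i j : rows s -> i < n -> j < n -> cell (ar (run init_span s) 3) i j = 0.
Proof.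
  intros Hrow. revert i j. unfold init_span.
  apply (for2_map NREGS n k 1 2 _ 3 (fun i j x => 0)); [reflexivity|discriminate|].
  intros i j s' Hi Hj _ Ha _ Vi Vj i' j' Hi' Hj'.
  assert (Hix : ar s' 1 i = i * n) by (rewrite Ha by reflexivity; auto).
  sx. rewrite Vi, Vj, Hix. now rewrite cell_upd.
Qed.

Lemma diag_ok a s i j : rows s -> a <> 1 -> i < n -> j < n ->
  cell (ar (run (diag a) s) a) i j = if i =? j then 0 else cell (ar s a) i j.
Proof.
  intros Hrow Hne Hi Hj. unfold diag.
  enough (H : forall i j, i < n -> j < n ->
    cell (ar (run (CFor 1 (CPut a (ix 1 1) (EC 0))) s) a) i j =
    if (i =? j) && (i <? n) then 0 else cell (ar s a) i j).
  { rewrite H by auto. apply Nat.ltb_lt in Hi. now rewrite Hi, andb_true_r. }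
  apply (for_inv NREGS n k 1 _ (fun m s' => forall i j, i < n -> j < n ->
    cell (ar s' a) i j = if (i =? j) && (i <? m) then 0 else cell (ar s a) i j)).
  - intros i' j' _ _. now rewrite andb_false_r.
  - intros m s' Hm _ Ha _ HI i' j' Hi' Hj'.
    assert (Hix : ar s' 1 m = m * n).
    { rewrite Ha; [auto|]. cbn [mod_arr]. apply Nat.eqb_neq. auto. }
    sx. rewrite Nat.eqb_refl, Hix, cell_upd, HI by auto.
    destruct (Nat.eqb_spec i' m) as [->|]; cbn [andb].
    + replace (m <? m) with false by (symmetry; apply Nat.ltb_irrefl).
      replace (m <? S m) with true by (symmetry; apply Nat.ltb_lt; lia).
      rewrite andb_false_r, andb_true_r, Nat.eqb_sym. reflexivity.
    + destruct (i' =? j'); cbn [andb]; [|reflexivity].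
      destruct (Nat.ltb_spec i' m), (Nat.ltb_spec i' (S m)); try lia; reflexivity.
Qed.

(** * Distances by in-place relaxation *)

Variable E : nat -> nat -> bool.

Definition is_input (s : st) : Prop := forall i j, i < n -> j < n -> bm (ar s 0) i j = E i j.

Definition dist_sound (s : st) : Prop := forall u v, u < n -> v < n ->
  cell (ar s 2) u v <= k -> reach_le n E (cell (ar s 2) u v) u v.
Definition dist_complete (t : nat) (s : st) : Prop := forall u v m, u < n -> v < n -> m <= t ->
  reach_le n E m u v -> m <= k -> cell (ar s 2) u v <= m.
Definition dist_le (s s' : st) : Prop := forall u v, u < n -> v < n ->
  cell (ar s' 2) u v <= cell (ar s 2) u v.
(** What relaxing the edge from [u] to [x] achieves when distances are complete up to length [t]; it
    persists because entries only decrease. *)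
Definition relaxed (t u x : nat) (s : st) : Prop := forall v m, v < n -> m <= t -> E u x = true ->
  reach_le n E m x v -> m < k -> cell (ar s 2) u v <= m + 1.

Lemma relaxed_le t u x s s' : u < n -> dist_le s s' -> relaxed t u x s -> relaxed t u x s'.
Proof. intros Hu Hle H v m Hv Hm He Hr Hk. eapply Nat.le_trans; [apply Hle; auto|]. now apply H. Qed.

Lemma complete_le t s s' : dist_le s s' -> dist_complete t s -> dist_complete t s'.
Proof. intros Hle H u v m Hu Hv Hm Hr Hk. eapply Nat.le_trans; [apply Hle; auto|]. now apply H. Qed.

Lemma dist_le_refl s : dist_le s s.
Proof. intros u v _ _. apply le_n. Qed.

Lemma dist_le_trans s1 s2 s3 : dist_le s1 s2 -> dist_le s2 s3 -> dist_le s1 s3.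
Proof. intros H1 H2 u v Hu Hv. eapply Nat.le_trans; [apply H2|apply H1]; auto. Qed.

(** Updating in place is harmless: entries only decrease and, up to [k], remain lengths of actual
    walks, so completeness at the start of a round holds throughout it. *)
Lemma relax_row_ok t s u x : rows s -> is_input s -> vr s 1 = u -> vr s 3 = x -> u < n -> x < n ->
  dist_sound s -> dist_complete t s ->
  dist_sound (run relax_row s) /\ dist_le s (run relax_row s) /\ relaxed t u x (run relax_row s).
Proof.
  intros Hrow Hin Vu Vx Hu Hx Hs Hc. unfold relax_row.
  (* The bound [v < n] is doubled: one copy is the instance at [n] of the invariant's [v < j], the
     other is the range of [v]. *)
  enough (G : dist_sound (run relax_row s) /\ dist_le s (run relax_row s) /\
    forall v m, v < n -> v < n -> m <= t -> E u x = true -> reach_le n E m x v -> m < k ->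
       cell (ar (run relax_row s) 2) u v <= m + 1).
  { destruct G as (G1 & G2 & G3). split; [auto|split; [auto|]]. intros v m Hv. auto. }
  apply (for_inv NREGS n k 2 _ (fun j s' => dist_sound s' /\ dist_le s s' /\
    forall v m, v < j -> v < n -> m <= t -> E u x = true -> reach_le n E m x v -> m < k ->
       cell (ar s' 2) u v <= m + 1)).
  - split; [auto|split; [apply dist_le_refl|lia]].
  - intros j s' Hj Hv Ha _ (I1 & I2 & I3).
    assert (R1 : ar s' 1 u = u * n) by (rewrite Ha by reflexivity; auto).
    assert (R3 : ar s' 1 x = x * n) by (rewrite Ha by reflexivity; auto).
    assert (E0 : ar s' 0 = ar s 0) by (apply Ha; reflexivity).
    assert (V1 : vr s' 1 = u) by (rewrite Hv by reflexivity; auto).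
    assert (V3 : vr s' 3 = x) by (rewrite Hv by reflexivity; auto).
    sx. rewrite V1, V3, R1, R3, E0, !cell_ar.
    specialize (Hin u x Hu Hx). unfold bm in Hin.
    destruct (Nat.eqb_spec (cell (ar s 0) u x) 0) as [Z|Z]; cbn [negb] in Hin.
    { split; [auto|split; [auto|]]. intros v m _ _ _ He. congruence. }
    assert (Hstep : forall v m, v < S j -> v < n -> m <= t -> E u x = true -> reach_le n E m x v -> m < k ->
      v = j -> cell (ar s' 2) x j + 1 <= m + 1).
    { intros v m _ Hv' Hm _ Hr Hk ->. assert (cell (ar s' 2) x j <= m); [|lia].
      apply (complete_le t s s' I2 Hc); auto. lia. }
    destruct (Nat.eqb_spec (cell (ar s' 2) u j - (cell (ar s' 2) x j + 1)) 0) as [Z'|Z'].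
    { split; [auto|split; [auto|]]. intros v m Hvj Hvn Hm He Hr Hk.
      destruct (Nat.eq_dec v j) as [->|]; [|apply I3; auto; lia].
      specialize (Hstep j m Hvj Hvn Hm He Hr Hk eq_refl). cbn [setv ar]. lia. }
    assert (Hcell : forall u' v', u' < n -> v' < n ->
      cell (upd (ar s' 2) (u * n + j) (cell (ar s' 2) x j + 1)) u' v' =
      if (u' =? u) && (v' =? j) then cell (ar s' 2) x j + 1 else cell (ar s' 2) u' v')
      by (intros; now apply cell_upd).
    unfold dist_sound, dist_le. cbn [ar]. cbn [Nat.eqb]. split; [|split].
    + intros u' v' Hu' Hv'. rewrite Hcell by auto.
      destruct (Nat.eqb_spec u' u) as [->|]; cbn [andb]; [|auto].
      destruct (Nat.eqb_spec v' j) as [->|]; [|auto].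
      intros Hle. rewrite Nat.add_1_r. right. exists x. split; [auto|]. split; [auto|].
      apply I1; auto. lia.
    + intros u' v' Hu' Hv'. rewrite Hcell by auto. specialize (I2 u' v' Hu' Hv').
      destruct (Nat.eqb_spec u' u) as [->|]; cbn [andb]; [|auto].
      destruct (Nat.eqb_spec v' j) as [->|]; [|auto]. lia.
    + intros v m Hvj Hvn Hm He Hr Hk. rewrite Hcell by auto. rewrite Nat.eqb_refl. cbn [andb].
      destruct (Nat.eqb_spec v j) as [->|]; [|apply I3; auto; lia].
      apply (Hstep j m); auto.
Qed.

Lemma relax_round_ok t s : rows s -> is_input s -> dist_sound s -> dist_complete t s ->
  (forall u, u < n -> cell (ar s 2) u u = 0) ->
  dist_sound (run relax_round s) /\ dist_complete (S t) (run relax_round s) /\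
  dist_le s (run relax_round s).
Proof.
  intros Hrow Hin Hs Hc Hdiag.
  enough (G : dist_sound (run relax_round s) /\ dist_le s (run relax_round s) /\
     forall u x, u < n -> u < n -> x < n -> relaxed t u x (run relax_round s)).
  { destruct G as (G1 & G2 & G3). split; [auto|split; [|auto]].
    intros u v m Hu Hv Hm Hr Hmk. destruct m as [|m].
    - cbn in Hr. subst v. specialize (G2 u u Hu Hu). rewrite Hdiag in G2 by auto. lia.
    - destruct Hr as [<-|(w & Hw & He & Hr)].
      + specialize (G2 u u Hu Hu). rewrite Hdiag in G2 by auto. lia.
      + specialize (G3 u w Hu Hu Hw v m Hv). rewrite Nat.add_1_r in G3. apply G3; auto; lia. }
  unfold relax_round.
  apply (for_inv NREGS n k 1 _ (fun j s' => dist_sound s' /\ dist_le s s' /\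
     forall u x, u < j -> u < n -> x < n -> relaxed t u x s')).
  { split; [auto|split; [apply dist_le_refl|lia]]. }
  intros u s1 Hu Hv1 Ha1 _ (I1 & I2 & I3).
  assert (G : dist_sound (run relax_vertex (setv s1 1 u)) /\ dist_le s1 (run relax_vertex (setv s1 1 u)) /\
     forall x, x < n -> x < n -> relaxed t u x (run relax_vertex (setv s1 1 u))).
  { unfold relax_vertex.
    apply (for_inv NREGS n k 3 _ (fun j s' => dist_sound s' /\ dist_le s1 s' /\
      forall x, x < j -> x < n -> relaxed t u x s')).
    { split; [exact I1|split; [exact (dist_le_refl s1)|lia]]. }
    intros x s2 Hx Hv2 Ha2 _ (J1 & J2 & J3).
    assert (A1 : ar s2 1 = ar s 1) by (rewrite Ha2 by reflexivity; apply Ha1; reflexivity).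
    assert (A0 : ar s2 0 = ar s 0) by (rewrite Ha2 by reflexivity; apply Ha1; reflexivity).
    destruct (relax_row_ok t (setv s2 3 x) u x) as (K1 & K2 & K3); auto.
    - intros i Hi. cbn [setv ar]. rewrite A1. auto.
    - intros i j Hi Hj. cbn [setv ar]. rewrite A0. auto.
    - cbn [setv vr Nat.eqb]. rewrite Hv2 by reflexivity. reflexivity.
    - apply (complete_le t s); auto. apply dist_le_trans with s1; auto.
    - split; [auto|]. assert (K2' : dist_le s2 (run relax_row (setv s2 3 x))) by exact K2.
      split; [eapply dist_le_trans; eauto|].
      intros x' Hx' Hxn. destruct (Nat.eq_dec x' x) as [->|]; [auto|].
      eapply relaxed_le; [auto|exact K2'|]. apply J3; auto; lia. }
  destruct G as (G1 & G2 & G3). split; [auto|]. split; [eapply dist_le_trans; eauto|].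
  intros u' x Hu' Hun Hx. destruct (Nat.eq_dec u' u) as [->|]; [auto|].
  eapply relaxed_le; [auto|exact G2|]. apply I3; auto; lia.
Qed.

(** After [n] rounds walks of length up to [n] are accounted for; [reach_short] extends this to all
    lengths up to [k]. *)
Lemma distances_ok s : rows s -> is_input s ->
  (forall i j, i < n -> j < n -> cell (ar s 2) i j = if i =? j then 0 else k + 1) ->
  dist_spec n k E (cell (ar (run distances s) 2)).
Proof.
  intros Hrow Hin H0.
  assert (G : dist_sound (run distances s) /\ dist_complete n (run distances s) /\ dist_le s (run distances s)).
  { unfold distances.
    apply (for_inv NREGS n k 4 _ (fun t s' => dist_sound s' /\ dist_complete t s' /\ dist_le s s')).
    - split; [|split].
      + intros u v Hu Hv. rewrite H0 by auto. destruct (Nat.eqb_spec u v) as [->|]; [|lia].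
        intros _. apply reach_refl.
      + intros u v m Hu Hv Hm Hr _. replace m with 0 in * by lia. cbn in Hr. subst v.
        rewrite H0, Nat.eqb_refl by auto. lia.
      + apply dist_le_refl.
    - intros t s1 Ht Hv Ha _ (I1 & I2 & I3).
      destruct (relax_round_ok t (setv s1 4 t)) as (K1 & K2 & K3); auto.
      + intros i Hi. cbn [setv ar]. rewrite Ha by reflexivity. auto.
      + intros i j Hi Hj. cbn [setv ar]. rewrite Ha by reflexivity. auto.
      + intros u Hu. cbn [setv ar]. specialize (I3 u u Hu Hu). rewrite (H0 u u), Nat.eqb_refl in I3 by auto. lia.
      + split; [auto|split; [auto|]]. eapply dist_le_trans; eauto. }
  destruct G as (G1 & G2 & _). intros u v m Hu Hv Hm. split.
  - intros Hle. eapply reach_mono; [exact Hle|]. apply G1; auto. lia.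
  - intros Hr. destruct (reach_short n E m u v Hu Hr) as (d & Hd1 & Hd2 & Hr').
    eapply Nat.le_trans; [|exact Hd1]. apply G2; auto. lia.
Qed.


(** * Choosing the best root *)

Definition gain (s : st) (w : nat) : nat :=
  num_edges n (fun u v => bm (ar s 4) u v && cov k (cell (ar s 2)) w u v).

Lemma cov_eqb D w u v : (k + 1 - (D u w + D w v) =? 0) = negb (cov k D w u v).
Proof.
  unfold cov. destruct (Nat.leb_spec (D u w + D w v) k); cbn [negb];
    [apply Nat.eqb_neq|apply Nat.eqb_eq]; lia.
Qed.

Lemma count_row_ok s u w : rows s -> u < n -> w < n -> vr s 1 = u -> vr s 5 = w ->
  vr (run count_row s) 6 =
    vr s 6 + sumn n (fun v => Nat.b2n (bm (ar s 4) u v && cov k (cell (ar s 2)) w u v)).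
Proof.
  intros Hrow Hu Hw Vu Vw. unfold count_row.
  apply (for_inv NREGS n k 2 _ (fun j s' => vr s' 6 =
    vr s 6 + sumn j (fun v => Nat.b2n (bm (ar s 4) u v && cov k (cell (ar s 2)) w u v)))).
  - cbn. lia.
  - intros v s' Hv Hvr Har _ I.
    assert (R1 : ar s' 1 = ar s 1) by (apply Har; reflexivity).
    assert (A2 : ar s' 2 = ar s 2) by (apply Har; reflexivity).
    assert (A4 : ar s' 4 = ar s 4) by (apply Har; reflexivity).
    assert (V1 : vr s' 1 = u) by (rewrite Hvr by reflexivity; auto).
    assert (V5 : vr s' 5 = w) by (rewrite Hvr by reflexivity; auto).
    sx. rewrite V1, V5, R1, A2, A4, !Hrow, !cell_ar, cov_eqb by auto. cbn [sumn].
    unfold bm at 2. destruct (cell (ar s 4) u v =? 0); cbn [negb andb Nat.b2n setv vr Nat.eqb].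
    + rewrite I. lia.
    + destruct (cov k (cell (ar s 2)) w u v); cbn [negb andb Nat.b2n setv vr Nat.eqb]; rewrite I; lia.
Qed.

Lemma count_loop_ok s w : rows s -> w < n -> vr s 5 = w -> vr s 6 = 0 ->
  vr (run count_loop s) 6 = gain s w.
Proof.
  intros Hrow Hw Vw V0. unfold gain. rewrite num_edges_sumn. unfold count_loop.
  apply (for_inv NREGS n k 1 _ (fun j s' => vr s' 6 = sumn j (fun u => sumn n (fun v =>
     Nat.b2n (bm (ar s 4) u v && cov k (cell (ar s 2)) w u v))))).
  - exact V0.
  - intros u s' Hu Hvr Har _ I.
    rewrite (count_row_ok _ u w); auto.
    + cbn [setv ar vr Nat.eqb sumn]. rewrite !Har by reflexivity. now rewrite I.
    + intros i Hi. cbn [setv ar]. rewrite Har by reflexivity. auto.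
    + cbn [setv vr Nat.eqb]. rewrite Hvr by reflexivity. auto.
Qed.

Lemma search_best_ok s : rows s -> 0 < n ->
  let s' := run search_best s in
  (forall w, w < n -> gain s w <= vr s' 7) /\ vr s' 8 < n /\ vr s' 7 = gain s (vr s' 8).
Proof.
  intros Hrow Hn. cbv zeta. unfold search_best. cbn [run_cmd].
  set (s0 := setv (setv s 7 (eval n k (EC 0) s)) 8 _).
  (* During the loop the recorded value is only bounded by the gain of the recorded root, since the
     initial 0 need not be the gain of vertex 0; maximality restores equality at the end. *)
  enough (G : (forall w, w < n -> gain s w <= vr (run best_loop s0) 7) /\ vr (run best_loop s0) 8 < n /\
     vr (run best_loop s0) 7 <= gain s (vr (run best_loop s0) 8)).
  { destruct G as (G1 & G2 & G3). split; [auto|split; [auto|]]. apply Nat.le_antisymm; auto. }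
  unfold best_loop.
  apply (for_inv NREGS n k 5 _ (fun j s' => (forall w, w < j -> gain s w <= vr s' 7) /\ vr s' 8 < n /\
     vr s' 7 <= gain s (vr s' 8))).
  - split; [lia|]. split; [exact Hn|]. apply Nat.le_0_l.
  - intros w s1 Hw _ Har _ (I1 & I2 & I3). cbn [run_cmd].
    set (s2 := setv (setv s1 5 w) 6 _).
    assert (Hc : vr (run count_loop s2) 6 = gain s w).
    { rewrite (count_loop_ok s2 w); auto.
      - unfold gain. cbn [s2 setv ar]. now rewrite !Har by reflexivity.
      - intros i Hi. cbn [s2 setv ar]. rewrite Har by reflexivity. apply Hrow; auto. }
    assert (H7 : vr (run count_loop s2) 7 = vr s1 7) by (now rewrite run_vr by reflexivity).
    assert (H8 : vr (run count_loop s2) 8 = vr s1 8) by (now rewrite run_vr by reflexivity).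
    assert (H5 : vr (run count_loop s2) 5 = w) by (now rewrite run_vr by reflexivity).
    sx. rewrite Hc, H7.
    destruct (Nat.eqb_spec (gain s w - vr s1 7) 0) as [Z|Z].
    + sx. rewrite H7, H8. split; [|auto]. intros w' Hw'.
      destruct (Nat.eq_dec w' w) as [->|]; [lia|apply I1; lia].
    + sx. rewrite H5. split; [|split; auto]. intros w' Hw'.
      destruct (Nat.eq_dec w' w) as [->|]; [lia|]. specialize (I1 w'). lia.
Qed.

(** * Shortest-path trees *)

Lemma search_ok (e1 e2 : expr) (good : nat -> Prop) s :
  let srch := CFor 3 (CIf e1 (CIf e2 CSkip (CSet 9 (EAdd (EV 3) (EC 1)))) CSkip) in
  (forall x s', x < n -> (forall y, y <> 3 -> y <> 9 -> vr s' y = vr s y) -> (forall a, ar s' a = ar s a) ->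
     vr s' 3 = x -> (eval n k e1 s' <> 0 /\ eval n k e2 s' = 0 <-> good x)) ->
  vr s 9 = 0 ->
  let f := vr (run srch s) 9 in
  (f <> 0 -> f - 1 < n /\ good (f - 1)) /\ (f = 0 -> forall x, x < n -> ~ good x).
Proof.
  intros srch He H0. cbv zeta. unfold srch.
  apply (for_inv NREGS n k 3 _ (fun j s' =>
    (vr s' 9 <> 0 -> vr s' 9 - 1 < n /\ good (vr s' 9 - 1)) /\ (vr s' 9 = 0 -> forall x, x < j -> ~ good x))).
  - split; [now rewrite H0|lia].
  - intros x s' Hx Hvr Har _ [I1 I2]. specialize (He x (setv s' 3 x) Hx). cbn [run_cmd].
    assert (Hg : eval n k e1 (setv s' 3 x) <> 0 /\ eval n k e2 (setv s' 3 x) = 0 <-> good x).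
    { apply He.
      - intros y Hy3 Hy9. cbn [setv vr]. apply Nat.eqb_neq in Hy3, Hy9. rewrite Hy3.
        apply Hvr. cbn [mod_var]. now rewrite Hy3, Hy9.
      - intros a. cbn [setv ar]. now apply Har.
      - reflexivity. }
    assert (Hbad : ~ good x -> (vr s' 9 <> 0 -> vr s' 9 - 1 < n /\ good (vr s' 9 - 1)) /\
       (vr s' 9 = 0 -> forall x', x' < S x -> ~ good x')).
    { intros Hb. split; [auto|]. intros Hf x' Hx'. destruct (Nat.eq_dec x' x) as [->|]; [auto|].
      apply I2; auto; lia. }
    destruct (Nat.eqb_spec (eval n k e1 (setv s' 3 x)) 0) as [Z1|Z1].
    { sx. apply Hbad. tauto. }
    destruct (Nat.eqb_spec (eval n k e2 (setv s' 3 x)) 0) as [Z2|Z2].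
    + sx. rewrite Nat.add_sub. split; [|lia]. intros _. split; [auto|]. now apply Hg.
    + sx. apply Hbad. tauto.
Qed.

(* One edge per vertex: [pos u x] is the edge of the tree joining [u] to its neighbour [x]. *)
Lemma tree_ok (srch : cmd) (addr : expr) (good : nat -> nat -> Prop) (pos : nat -> nat -> nat * nat) s :
  (forall y, y <> 3 -> y <> 9 -> mod_var srch y = false) -> (forall a, mod_arr srch a = false) ->
  (forall u s', u < n -> vr s' 5 = vr s 5 -> (forall a, a <> 3 -> ar s' a = ar s a) -> vr s' 1 = u ->
     vr s' 9 = 0 -> let f := vr (run srch s') 9 in
     (f <> 0 -> f - 1 < n /\ good u (f - 1)) /\ (f = 0 -> forall x, x < n -> ~ good u x)) ->
  (forall u s', u < n -> (forall a, a <> 3 -> ar s' a = ar s a) -> vr s' 1 = u -> vr s' 9 - 1 < n ->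
     eval n k addr s' = fst (pos u (vr s' 9 - 1)) * n + snd (pos u (vr s' 9 - 1))) ->
  (forall u x, u < n -> x < n -> snd (pos u x) < n) ->
  let s' := run (CFor 1 (CSeq (CSet 9 (EC 0)) (CSeq srch (CIf (EV 9) (CPut 3 addr (EC 1)) CSkip)))) s in
  (forall i j, i < n -> j < n -> bm (ar s 3) i j = true -> bm (ar s' 3) i j = true) /\
  (forall i j, i < n -> j < n -> bm (ar s' 3) i j = true ->
     bm (ar s 3) i j = true \/ exists u x, u < n /\ x < n /\ good u x /\ pos u x = (i, j)) /\
  num_edges n (bm (ar s' 3)) <= num_edges n (bm (ar s 3)) + n /\
  (forall u x, u < n -> x < n -> good u x ->
     exists x', x' < n /\ good u x' /\ bm (ar s' 3) (fst (pos u x')) (snd (pos u x')) = true).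
Proof.
  intros Hmv Hma Hsrch Haddr Hpos. cbv zeta.
  set (body := CSeq _ _).
  enough (G :
    (forall i j, i < n -> j < n -> bm (ar s 3) i j = true -> bm (ar (run (CFor 1 body) s) 3) i j = true) /\
    (forall i j, i < n -> j < n -> bm (ar (run (CFor 1 body) s) 3) i j = true ->
       bm (ar s 3) i j = true \/ exists u x, u < n /\ x < n /\ good u x /\ pos u x = (i, j)) /\
    num_edges n (bm (ar (run (CFor 1 body) s) 3)) <= num_edges n (bm (ar s 3)) + n /\
    (forall u x, u < n -> u < n -> x < n -> good u x ->
       exists x', x' < n /\ good u x' /\
         bm (ar (run (CFor 1 body) s) 3) (fst (pos u x')) (snd (pos u x')) = true)).
  { destruct G as (G1 & G2 & G3 & G4). split; [exact G1|split; [exact G2|split; [exact G3|]]].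
    intros u x Hu. exact (G4 u x Hu Hu). }
  apply (for_inv NREGS n k 1 _ (fun t s' =>
    (forall i j, i < n -> j < n -> bm (ar s 3) i j = true -> bm (ar s' 3) i j = true) /\
    (forall i j, i < n -> j < n -> bm (ar s' 3) i j = true ->
       bm (ar s 3) i j = true \/ exists u x, u < n /\ x < n /\ good u x /\ pos u x = (i, j)) /\
    num_edges n (bm (ar s' 3)) <= num_edges n (bm (ar s 3)) + t /\
    (forall u x, u < t -> u < n -> x < n -> good u x ->
       exists x', x' < n /\ good u x' /\ bm (ar s' 3) (fst (pos u x')) (snd (pos u x')) = true))).
  { repeat split; auto; lia. }
  intros u s1 Hu Hvr Har _ (I1 & I2 & I3 & I4).
  assert (Har1 : forall a, a <> 3 -> ar s1 a = ar s a).
  { intros a Ha. apply Har. cbn [body mod_arr]. rewrite Hma. apply Nat.eqb_neq in Ha. now rewrite Ha. }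
  assert (Hv5 : vr s1 5 = vr s 5).
  { apply Hvr. cbn [body mod_var]. rewrite Hmv by discriminate. reflexivity. }
  unfold body. cbn [run_cmd]. set (s2 := setv (setv s1 1 u) 9 _).
  destruct (Hsrch u s2 Hu) as [S1 S2]; auto. cbv zeta in S1, S2.
  set (s3 := run srch s2) in *.
  assert (A3 : forall a, ar s3 a = ar s1 a) by (intros a; unfold s3; rewrite run_ar; auto).
  assert (V3 : vr s3 1 = u) by (unfold s3; rewrite run_vr by (apply Hmv; discriminate); reflexivity).
  cbn [eval].
  destruct (Nat.eqb_spec (vr s3 9) 0) as [Z|Z].
  - rewrite !A3. split; [auto|split; [auto|split; [lia|]]].
    intros u' x Hu' Hun Hx Hg. destruct (Nat.eq_dec u' u) as [->|].
    + exfalso. now apply (S2 Z x Hx).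
    + apply I4 with x; auto; lia.
  - destruct (S1 Z) as [Hf Hg]. sx.
    rewrite (Haddr u s3) by (auto; intros; rewrite A3; auto).
    set (x := vr s3 9 - 1) in *. rewrite !A3.
    assert (Hbm : forall i j, i < n -> j < n ->
       bm (upd (ar s1 3) (fst (pos u x) * n + snd (pos u x)) 1) i j =
       (i =? fst (pos u x)) && (j =? snd (pos u x)) || bm (ar s1 3) i j).
    { intros i j Hi Hj. unfold bm. rewrite cell_upd by auto.
      destruct ((i =? fst (pos u x)) && (j =? snd (pos u x))); reflexivity. }
    split; [|split; [|split]].
    + intros i j Hi Hj Hb. rewrite Hbm, (I1 i j) by auto. apply orb_true_r.
    + intros i j Hi Hj. rewrite Hbm, orb_true_iff, andb_true_iff, !Nat.eqb_eq by auto.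
      intros [[-> ->]|Hb]; [right|auto]. exists u, x. repeat split; auto. now destruct (pos u x).
    + enough (num_edges n (bm (upd (ar s1 3) (fst (pos u x) * n + snd (pos u x)) 1)) <=
              S (num_edges n (bm (ar s1 3)))) by lia.
      apply num_edges_add1 with (a := fst (pos u x)) (b := snd (pos u x)).
      intros i j Hi Hj. rewrite Hbm, orb_true_iff, andb_true_iff, !Nat.eqb_eq by auto. tauto.
    + intros u' x' Hu' Hun Hx' Hg'.
      assert (Hnew : forall i j, j < n -> bm (ar s1 3) i j = true ->
         bm (upd (ar s1 3) (fst (pos u x) * n + snd (pos u x)) 1) i j = true).
      { intros i j Hj. unfold bm. rewrite cell_upd by auto. now destruct (_ && _). }
      destruct (Nat.eq_dec u' u) as [->|].
      * exists x. split; [auto|split; [auto|]]. unfold bm. rewrite cell_upd by auto.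
        now rewrite !Nat.eqb_refl.
      * destruct (I4 u' x') as (x'' & ? & ? & ?); auto; [lia|]. exists x''. auto.
Qed.

Lemma neq_expr_ok e1 e2 s : eval n k (neq_expr e1 e2) s = 0 <-> eval n k e1 s = eval n k e2 s.
Proof. cbn [neq_expr eval]. lia. Qed.

Lemma in_tree_ok s w : rows s -> is_input s -> w < n -> vr s 5 = w ->
  let s' := run in_tree s in
  let D := cell (ar s 2) in
  (forall i j, i < n -> j < n -> bm (ar s 3) i j = true -> bm (ar s' 3) i j = true) /\
  (forall i j, i < n -> j < n -> bm (ar s' 3) i j = true -> bm (ar s 3) i j = true \/ E i j = true) /\
  num_edges n (bm (ar s' 3)) <= num_edges n (bm (ar s 3)) + n /\
  (forall u x, u < n -> x < n -> E u x = true -> D x w + 1 = D u w ->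
     exists x', x' < n /\ D x' w + 1 = D u w /\ bm (ar s' 3) u x' = true).
Proof.
  intros Hrow Hin Hw Vw. cbv zeta.
  destruct (tree_ok in_search (EAdd (EArr 1 (EV 1)) (ESub (EV 9) (EC 1)))
    (fun u x => E u x = true /\ cell (ar s 2) x w + 1 = cell (ar s 2) u w) (fun u x => (u, x)) s)
    as (G1 & G2 & G3 & G4).
  - intros y H3 H9. cbn. apply Nat.eqb_neq in H3, H9. now rewrite H3, H9.
  - reflexivity.
  - intros u s' Hu V5 Ha V1 V9. apply (search_ok (EArr 0 (ix 1 3)) (neq_expr (EAdd (EArr 2 (ix 3 5)) (EC 1)) (EArr 2 (ix 1 5)))
      (fun x => E u x = true /\ cell (ar s 2) x w + 1 = cell (ar s 2) u w)); [|exact V9].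
    intros x s'' Hx Hv Ha' V3. rewrite neq_expr_ok.
    assert (A0 : ar s'' 0 = ar s 0) by (rewrite Ha'; apply Ha; discriminate).
    assert (A1 : ar s'' 1 = ar s 1) by (rewrite Ha'; apply Ha; discriminate).
    assert (A2 : ar s'' 2 = ar s 2) by (rewrite Ha'; apply Ha; discriminate).
    assert (V1' : vr s'' 1 = u) by (rewrite Hv by discriminate; auto).
    assert (V5' : vr s'' 5 = w) by (rewrite Hv by discriminate; rewrite V5; auto).
    sx. rewrite A0, A1, A2, V1', V3, V5', !Hrow, !cell_ar by auto.
    rewrite <- (Hin u x) by auto. unfold bm. rewrite negb_true_iff, Nat.eqb_neq. tauto.
  - intros u s' Hu Ha V1 V9. cbn [eval fst snd]. rewrite Ha by discriminate. rewrite V1, Hrow by auto. reflexivity.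
  - auto.
  - unfold in_tree. split; [exact G1|]. split; [|split; [exact G3|]].
    + intros i j Hi Hj Hb. destruct (G2 i j Hi Hj Hb) as [|(u & x & _ & _ & [He _] & [= <- <-])]; auto.
    + intros u x Hu Hx He Hd. destruct (G4 u x) as (x' & H1 & [H2 H3] & H4); auto. exists x'. auto.
Qed.

Lemma out_tree_ok s w : rows s -> is_input s -> w < n -> vr s 5 = w ->
  let s' := run out_tree s in
  let D := cell (ar s 2) in
  (forall i j, i < n -> j < n -> bm (ar s 3) i j = true -> bm (ar s' 3) i j = true) /\
  (forall i j, i < n -> j < n -> bm (ar s' 3) i j = true -> bm (ar s 3) i j = true \/ E i j = true) /\
  num_edges n (bm (ar s' 3)) <= num_edges n (bm (ar s 3)) + n /\
  (forall v x, v < n -> x < n -> E x v = true -> D w x + 1 = D w v ->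
     exists x', x' < n /\ D w x' + 1 = D w v /\ bm (ar s' 3) x' v = true).
Proof.
  intros Hrow Hin Hw Vw. cbv zeta.
  destruct (tree_ok out_search (EAdd (EArr 1 (ESub (EV 9) (EC 1))) (EV 1))
    (fun v x => E x v = true /\ cell (ar s 2) w x + 1 = cell (ar s 2) w v) (fun v x => (x, v)) s)
    as (G1 & G2 & G3 & G4).
  - intros y H3 H9. cbn. apply Nat.eqb_neq in H3, H9. now rewrite H3, H9.
  - reflexivity.
  - intros u s' Hu V5 Ha V1 V9. apply (search_ok (EArr 0 (ix 3 1)) (neq_expr (EAdd (EArr 2 (ix 5 3)) (EC 1)) (EArr 2 (ix 5 1)))
      (fun x => E x u = true /\ cell (ar s 2) w x + 1 = cell (ar s 2) w u)); [|exact V9].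
    intros x s'' Hx Hv Ha' V3. rewrite neq_expr_ok.
    assert (A0 : ar s'' 0 = ar s 0) by (rewrite Ha'; apply Ha; discriminate).
    assert (A1 : ar s'' 1 = ar s 1) by (rewrite Ha'; apply Ha; discriminate).
    assert (A2 : ar s'' 2 = ar s 2) by (rewrite Ha'; apply Ha; discriminate).
    assert (V1' : vr s'' 1 = u) by (rewrite Hv by discriminate; auto).
    assert (V5' : vr s'' 5 = w) by (rewrite Hv by discriminate; rewrite V5; auto).
    sx. rewrite A0, A1, A2, V1', V3, V5', !Hrow, !cell_ar by auto.
    rewrite <- (Hin x u) by auto. unfold bm. rewrite negb_true_iff, Nat.eqb_neq. tauto.
  - intros u s' Hu Ha V1 V9. cbn [eval fst snd]. rewrite Ha by discriminate. rewrite V1, Hrow by auto. reflexivity.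
  - auto.
  - unfold out_tree. split; [exact G1|]. split; [|split; [exact G3|]].
    + intros i j Hi Hj Hb. destruct (G2 i j Hi Hj Hb) as [|(u & x & _ & _ & [He _] & [= <- <-])]; auto.
    + intros u x Hu Hx He Hd. destruct (G4 u x) as (x' & H1 & [H2 H3] & H4); auto. exists x'. auto.
Qed.

(** Each kept edge lowers the distance to [w] by one, so following them reaches [w] along a shortest
    path. A candidate neighbour exists whenever [0 < D u w <= k]: the first vertex of a shortest
    walk is exactly one step closer, by the triangle inequality. *)
Lemma in_tree_reach D H w : dist_spec n k E D -> w < n ->
  (forall u x, u < n -> x < n -> E u x = true -> D x w + 1 = D u w ->
     exists x', x' < n /\ D x' w + 1 = D u w /\ H u x' = true) ->
  forall d u, u < n -> D u w <= d -> d <= k -> reach_le n H d u w.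
Proof.
  intros HD Hw Ht. induction d as [|d IH]; intros u Hu Hd Hk.
  - apply (HD u w 0) in Hd; auto.
  - destruct (Nat.le_gt_cases (D u w) d) as [Hle|Hgt].
    { apply reach_mono with d; [lia|]. apply IH; auto. lia. }
    apply (HD u w (S d)) in Hd as Hr; auto.
    destruct Hr as [->|(x & Hx & He & Hr)]; [apply reach_refl|].
    apply (HD x w d) in Hr; auto; [|lia].
    assert (D u w <= S (D x w)).
    { apply HD; auto; [lia|]. right. exists x. repeat split; auto. apply HD; auto. lia. }
    destruct (Ht u x Hu Hx He) as (x' & Hx' & Hd' & Hh); [lia|].
    right. exists x'. repeat split; auto. apply IH; auto; lia.
Qed.

(** The mirror image of the in-tree. As [reach_le] peels off first edges, the last edge is obtained
    from [reach_last] and appended by [reach_trans]. *)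
Lemma out_tree_reach D H w : dist_spec n k E D -> w < n ->
  (forall v x, v < n -> x < n -> E x v = true -> D w x + 1 = D w v ->
     exists x', x' < n /\ D w x' + 1 = D w v /\ H x' v = true) ->
  forall d v, v < n -> D w v <= d -> d <= k -> reach_le n H d w v.
Proof.
  intros HD Hw Ht. induction d as [|d IH]; intros v Hv Hd Hk.
  - apply (HD w v 0) in Hd; auto.
  - destruct (Nat.le_gt_cases (D w v) d) as [Hle|Hgt].
    { apply reach_mono with d; [lia|]. apply IH; auto. lia. }
    apply (HD w v (S d)) in Hd as Hr; auto.
    destruct (reach_last n E d w v Hw Hr) as [->|(x & Hx & Hr' & He)]; [apply reach_refl|].
    apply (HD w x d) in Hr'; auto; [|lia].
    assert (D w v <= D w x + 1).
    { apply HD; auto; [lia|]. apply reach_trans with x; [apply HD; auto; lia|]. now apply reach_edge. }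
    destruct (Ht v x Hv Hx He) as (x' & Hx' & Hd' & Hh); [lia|].
    replace (S d) with (d + 1) by lia. apply reach_trans with x'; [apply IH; auto; lia|]. now apply reach_edge.
Qed.

(** * Removing covered edges, completing the spanner and writing it out *)

Lemma remove_ok s w i j : rows s -> w < n -> vr s 5 = w -> i < n -> j < n ->
  bm (ar (run remove s) 4) i j = bm (ar s 4) i j && negb (cov k (cell (ar s 2)) w i j).
Proof.
  intros Hrow Hw Vw Hi Hj. unfold bm, remove, for_for.
  rewrite (for2_map NREGS n k 1 2 _ 4 (fun i j x => if cov k (cell (ar s 2)) w i j then 0 else x)); auto.
  { destruct (cov _ _ _ _ _); cbn; [now rewrite andb_false_r|now rewrite andb_true_r]. }
  clear i j Hi Hj. intros i j s' Hi Hj Hv Ha _ Vi Vj i' j' Hi' Hj'.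
  assert (R1 : ar s' 1 = ar s 1) by (apply Ha; reflexivity).
  assert (A2 : ar s' 2 = ar s 2) by (apply Ha; reflexivity).
  assert (V5 : vr s' 5 = w) by (rewrite Hv by reflexivity; auto).
  sx. rewrite Vi, Vj, V5, R1, A2, !Hrow, !cell_ar, cov_eqb by auto.
  destruct (cov k (cell (ar s 2)) w i j); cbn [negb].
  - sx. now rewrite cell_upd.
  - destruct (Nat.eqb_spec i' i) as [->|]; [|reflexivity].
    destruct (Nat.eqb_spec j' j) as [->|]; reflexivity.
Qed.

Lemma finish_ok s i j : rows s -> i < n -> j < n ->
  bm (ar (run finish s) 3) i j = bm (ar s 3) i j || bm (ar s 4) i j.
Proof.
  intros Hrow Hi Hj. unfold bm, finish, for_for.
  rewrite (for2_map NREGS n k 1 2 _ 3 (fun i j x => if cell (ar s 4) i j =? 0 then x else 1)); auto.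
  { destruct (cell (ar s 4) i j =? 0); cbn; [now rewrite orb_false_r|now rewrite orb_true_r]. }
  clear i j Hi Hj. intros i j s' Hi Hj Hv Ha _ Vi Vj i' j' Hi' Hj'.
  assert (R1 : ar s' 1 = ar s 1) by (apply Ha; reflexivity).
  assert (A4 : ar s' 4 = ar s 4) by (apply Ha; reflexivity).
  sx. rewrite Vi, Vj, R1, A4, !Hrow, !cell_ar by auto.
  destruct (cell (ar s 4) i j =? 0).
  - destruct (Nat.eqb_spec i' i) as [->|]; [|reflexivity].
    destruct (Nat.eqb_spec j' j) as [->|]; reflexivity.
  - sx. now rewrite cell_upd.
Qed.

(** Writes below [NREGS] fail the guard and have no effect; those cells are filled from array 3 by
    the epilogue. *)
Lemma write_output_ok s : rows s ->
  forall y, NREGS <= 2 + y -> y < n * n -> rw (run write_output s) (2 + y) = ar s 3 y.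
Proof.
  intros Hrow. unfold write_output, for_for.
  apply (for_inv NREGS n k 1 _ (fun i s' => forall y, NREGS <= 2 + y -> y < i * n -> rw s' (2 + y) = ar s 3 y)).
  { lia. }
  intros i s1 Hi _ Ha1 _ I1.
  enough (G : forall y, NREGS <= 2 + y -> y < i * n + n ->
     rw (run (CFor 2 (CWrite (EAdd (ix 1 2) (EC 2)) (EArr 3 (ix 1 2)))) (setv s1 1 i)) (2 + y) = ar s 3 y).
  { intros y Hy Hlt. apply G; lia. }
  apply (for_inv NREGS n k 2 _ (fun j s' => forall y, NREGS <= 2 + y -> y < i * n + j -> rw s' (2 + y) = ar s 3 y)).
  { intros y Hy Hlt. apply I1; lia. }
  intros j s2 Hj Hv2 Ha2 _ I2 y Hy Hlt.
  assert (R1 : ar s2 1 = ar s 1) by (rewrite Ha2 by reflexivity; apply Ha1; reflexivity).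
  assert (A3 : ar s2 3 = ar s 3) by (rewrite Ha2 by reflexivity; apply Ha1; reflexivity).
  assert (V1 : vr s2 1 = i) by (rewrite Hv2 by reflexivity; reflexivity).
  sx. rewrite V1, R1, A3, !Hrow by auto.
  assert (Hij : i * n + j < n * n) by nia.
  destruct (in_raw NREGS n (i * n + j + 2)) eqn:G.
  - sx. destruct (Nat.eq_dec y (i * n + j)) as [->|Hne].
    + replace (2 + (i * n + j)) with (i * n + j + 2) by lia. apply upd_same.
    + rewrite upd_other by lia. apply I2; lia.
  - sx. apply I2; auto. destruct (Nat.eq_dec y (i * n + j)) as [->|]; [|lia].
    exfalso. enough (in_raw NREGS n (i * n + j + 2) = true) by congruence.
    unfold in_raw, base. rewrite andb_true_iff, Nat.leb_le, Nat.ltb_lt. lia.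
Qed.

(** * The greedy invariant *)

Definition greedy_inv (s : st) : Prop :=
  rows s /\ is_input s /\ dist_spec n k E (cell (ar s 2)) /\
  (forall i j, i < n -> j < n -> bm (ar s 4) i j = true -> E i j = true /\ i <> j) /\
  (forall i j, i < n -> j < n -> bm (ar s 3) i j = true -> E i j = true) /\
  (forall u v, u < n -> v < n -> E u v = true -> u <> v ->
     bm (ar s 4) u v = true \/ reach_le n (bm (ar s 3)) k u v).

(** An edge leaves array 4 only if [D u w + D w v <= k]; the in-tree path to [w] followed by the
    out-tree path from [w] then spans it. Both trees survive because the spanner only grows. The
    remaining count drops by exactly the gain, which counts the removed edges. *)
Lemma greedy_step_ok s : greedy_inv s -> 0 < n ->
  let s' := run greedy_step s in
  greedy_inv s' /\
  exists g, (forall w, w < n -> gain s w <= g) /\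
    ((g < 2 * n /\ num_edges n (bm (ar s' 4)) = num_edges n (bm (ar s 4)) /\
       num_edges n (bm (ar s' 3)) = num_edges n (bm (ar s 3))) \/
     (2 * n <= g /\ num_edges n (bm (ar s' 4)) + g = num_edges n (bm (ar s 4)) /\
       num_edges n (bm (ar s' 3)) <= num_edges n (bm (ar s 3)) + 2 * n)).
Proof.
  intros (Hrow & Hin & HD & HR & HS & Hcov) Hn. cbv zeta.
  unfold greedy_step. cbn [run_cmd].
  destruct (search_best_ok s Hrow Hn) as (B1 & B2 & B3). cbv zeta in B1, B2, B3.
  set (s1 := run search_best s) in *.
  assert (A1 : forall a, ar s1 a = ar s a) by (intros a; unfold s1; now apply run_ar).
  sx. destruct (Nat.eqb_spec (vr s1 7 + 1 - (n + n)) 0) as [Z|Z].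
  - split.
    + unfold greedy_inv, rows, is_input. rewrite !A1. auto 10.
    + exists (vr s1 7). split; [auto|]. left. rewrite !A1. lia.
  - set (w := vr s1 8) in *. unfold pick. cbn [run_cmd].
    set (s2 := setv s1 5 _).
    assert (A2 : forall a, ar s2 a = ar s a) by (intros a; apply A1).
    assert (W2 : vr s2 5 = w) by reflexivity.
    destruct (in_tree_ok s2 w) as (T1 & T2 & T3 & T4); auto.
    { unfold rows. now rewrite A2. }
    { unfold is_input. now rewrite A2. }
    cbv zeta in T1, T2, T3, T4.
    set (s3 := run in_tree s2) in *.
    assert (A3 : forall a, a <> 3 -> ar s3 a = ar s a).
    { intros a Ha. unfold s3. rewrite run_ar; [apply A2|]. cbn. apply Nat.eqb_neq in Ha. now rewrite Ha. }
    assert (W3 : vr s3 5 = w) by (unfold s3; now rewrite run_vr by reflexivity).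
    destruct (out_tree_ok s3 w) as (U1 & U2 & U3 & U4); auto.
    { unfold rows. now rewrite A3. }
    { unfold is_input. now rewrite A3. }
    cbv zeta in U1, U2, U3, U4.
    set (s4 := run out_tree s3) in *.
    assert (A4 : forall a, a <> 3 -> ar s4 a = ar s a).
    { intros a Ha. unfold s4. rewrite run_ar; [apply A3; auto|]. cbn. apply Nat.eqb_neq in Ha. now rewrite Ha. }
    assert (W4 : vr s4 5 = w) by (unfold s4; now rewrite run_vr by reflexivity).
    assert (M4 : forall i j, i < n -> j < n ->
       bm (ar (run remove s4) 4) i j = bm (ar s 4) i j && negb (cov k (cell (ar s 2)) w i j)).
    { intros i j Hi Hj. rewrite (remove_ok s4 w), !A4; auto. unfold rows. now rewrite A4. }
    set (s5 := run remove s4) in *.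
    assert (A5 : forall a, a <> 4 -> ar s5 a = ar s4 a).
    { intros a Ha. unfold s5. apply run_ar. cbn. apply Nat.eqb_neq in Ha. now rewrite Ha. }
    rewrite !A2 in *. rewrite !(A3 2) in * by discriminate.
    assert (Hmono : forall i j, i < n -> j < n -> bm (ar s 3) i j = true -> bm (ar s5 3) i j = true).
    { intros i j Hi Hj Hb. rewrite A5 by discriminate. auto. }
    split.
    + unfold greedy_inv, rows, is_input. rewrite !(A5 0), !(A5 1), !(A5 2), !(A4 0), !(A4 1), !(A4 2) by discriminate.
      split; [auto|]. split; [auto|]. split; [auto|]. split; [|split].
      * intros i j Hi Hj. rewrite M4 by auto. rewrite andb_true_iff. intros [Hb _]. auto.
      * intros i j Hi Hj. rewrite A5 by discriminate. intros Hb.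
        destruct (U2 i j Hi Hj Hb) as [Hb'|]; [|auto]. destruct (T2 i j Hi Hj Hb'); auto.
      * intros u v Hu Hv He Hne. rewrite M4 by auto.
        destruct (Hcov u v Hu Hv He Hne) as [Hr|Hr].
        -- rewrite Hr. cbn [andb]. destruct (cov k (cell (ar s 2)) w u v) eqn:C; [right|now left].
           unfold cov in C. apply Nat.leb_le in C.
           eapply reach_mono; [exact C|]. apply reach_trans with w.
           ++ apply reach_sub with (H := bm (ar s3 3)); auto.
              { intros i j Hi Hj Hb. rewrite A5 by discriminate. auto. }
              eapply in_tree_reach; eauto. lia.
           ++ eapply out_tree_reach; eauto; [|lia].
              intros v' x Hv' Hx He' Hd. rewrite A5 by discriminate. eauto.
        -- right. apply reach_sub with (H := bm (ar s 3)); auto.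
    + exists (vr s1 7). split; [auto|]. right. split; [lia|]. split.
      * rewrite (num_edges_ext n _ (fun i j => bm (ar s 4) i j && negb (cov k (cell (ar s 2)) w i j))) by auto.
        rewrite B3. unfold gain.
        pose proof (num_edges_split n (bm (ar s 4)) (cov k (cell (ar s 2)) w)). cbv beta in *. lia.
      * rewrite A5 by discriminate. lia.
Qed.

End Verify.

Lemma mod_raw_unpack r : forall i, mod_raw (unpack i r) = false.
Proof. induction r as [|r IH]; intros i; [reflexivity|exact (IH (S i))]. Qed.

(** * Assembling the program and its guarantees *)

Section Final.
Variables (n k : nat) (E : nat -> nat -> bool).
Notation run := (run_cmd NREGS n k).
Notation enc := (encode_input n k E).

Lemma run_seq c1 c2 s : run (CSeq c1 c2) s = run c2 (run c1 s).
Proof. reflexivity. Qed.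

Lemma encode_cell i j : i < n -> j < n -> enc (2 + (i * n + j)) = Nat.b2n (E i j).
Proof.
  intros Hi Hj. unfold encode_input.
  assert (i * n + j < n * n) by nia.
  replace (2 + (i * n + j) =? 0) with false by (symmetry; apply Nat.eqb_neq; lia).
  replace (2 + (i * n + j) =? 1) with false by (symmetry; apply Nat.eqb_neq; lia).
  replace (2 + (i * n + j) <? 2 + n * n) with true by (symmetry; apply Nat.ltb_lt; lia).
  replace (2 + (i * n + j) - 2) with (i * n + j) by lia.
  rewrite Nat.div_add_l, Nat.div_small, Nat.add_0_r by lia.
  rewrite Nat.add_comm, Nat.Div0.mod_add, Nat.mod_small by lia. reflexivity.
Qed.

Lemma encode_le_1 y : 2 <= y -> enc y <= 1.
Proof.
  intros Hy. unfold encode_input. destruct (Nat.eqb_spec y 0); [lia|]. destruct (Nat.eqb_spec y 1); [lia|].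
  destruct (_ <? _); [|lia]. destruct (E _ _); lia.
Qed.

Lemma unpack_prog_ok s : vr s 0 = bits_val enc 2 (NREGS - 2) ->
  rw (run (unpack 2 (NREGS - 2)) s) = rw s /\
  forall y, y < NREGS - 2 -> ar (run (unpack 2 (NREGS - 2)) s) 0 y = enc (2 + y).
Proof.
  intros HV. split; [apply run_rw, mod_raw_unpack|].
  apply (unpack_ok n k enc (NREGS - 2) encode_le_1 2 s (le_n 2) HV).
Qed.

Lemma read_ok s : (forall y, y < NREGS - 2 -> ar s 0 y = enc (2 + y)) ->
  (forall y, NREGS <= y < base NREGS n -> rw s y = enc y) ->
  let s' := run read_input (run row_loop (run (CSet 10 (EC 0)) s)) in
  rows n s' /\ is_input n E s'.
Proof.
  intros U HW. cbv zeta. set (s2 := run (CSet 10 (EC 0)) s).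
  assert (R3 : rows n (run row_loop s2)) by (now apply row_loop_ok).
  assert (A3 : ar (run row_loop s2) 0 = ar s 0) by (now rewrite run_ar by reflexivity).
  assert (W3 : rw (run row_loop s2) = rw s) by (now rewrite run_rw by reflexivity).
  set (s3 := run row_loop s2) in *. clearbody s3. clear s2. split.
  - unfold rows. now rewrite run_ar by reflexivity.
  - intros i j Hi Hj. unfold bm. rewrite read_input_ok by auto. rewrite W3.
    assert (Hij : i * n + j < n * n) by nia.
    replace (if NREGS <=? 2 + (i * n + j) then rw s (2 + (i * n + j)) else cell n (ar s3 0) i j)
      with (Nat.b2n (E i j)); [now destruct (E i j)|].
    rewrite <- encode_cell by auto. destruct (Nat.leb_spec NREGS (2 + (i * n + j))).
    + symmetry. apply HW. unfold base. lia.
    + unfold cell. rewrite A3. symmetry. apply U. lia.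
Qed.

Lemma init_ok s4 : rows n s4 -> is_input n E s4 ->
  let s' := run distances (run init_span (run (diag 4) (run init_rem (run (diag 2) (run init_dist s4))))) in
  greedy_inv n k E s' /\ num_edges n (bm n (ar s' 3)) = 0.
Proof.
  intros R4 In4. cbv zeta.
  set (s5 := run init_dist s4).
  assert (R5 : rows n s5) by (unfold rows, s5; now rewrite run_ar by reflexivity).
  assert (A50 : ar s5 0 = ar s4 0) by (unfold s5; now rewrite run_ar by reflexivity).
  assert (D5 : forall i j, i < n -> j < n -> cell n (ar s5 2) i j = k + 1) by (intros; now apply init_dist_ok).
  clearbody s5. set (s6 := run (diag 2) s5).
  assert (R6 : rows n s6) by (unfold rows, s6; now rewrite run_ar by reflexivity).
  assert (A60 : ar s6 0 = ar s4 0) by (unfold s6; now rewrite run_ar by reflexivity).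
  assert (D6 : forall i j, i < n -> j < n -> cell n (ar s6 2) i j = if i =? j then 0 else k + 1).
  { intros i j Hi Hj. unfold s6. rewrite diag_ok, D5 by auto. reflexivity. }
  clearbody s6. set (s7 := run init_rem s6).
  assert (R7 : rows n s7) by (unfold rows, s7; now rewrite run_ar by reflexivity).
  assert (A70 : ar s7 0 = ar s4 0) by (unfold s7; now rewrite run_ar by reflexivity).
  assert (A72 : ar s7 2 = ar s6 2) by (unfold s7; now rewrite run_ar by reflexivity).
  assert (M7 : forall i j, i < n -> j < n -> cell n (ar s7 4) i j = cell n (ar s4 0) i j).
  { intros i j Hi Hj. unfold s7. rewrite init_rem_ok, A60 by auto. reflexivity. }
  clearbody s7. set (s8 := run (diag 4) s7).
  assert (R8 : rows n s8) by (unfold rows, s8; now rewrite run_ar by reflexivity).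
  assert (A80 : ar s8 0 = ar s4 0) by (unfold s8; now rewrite run_ar by reflexivity).
  assert (A82 : ar s8 2 = ar s6 2) by (unfold s8; now rewrite run_ar by reflexivity).
  assert (M8 : forall i j, i < n -> j < n -> bm n (ar s8 4) i j = E i j && negb (i =? j)).
  { intros i j Hi Hj. rewrite <- (In4 i j) by auto. unfold bm, s8. rewrite diag_ok, M7 by auto.
    destruct (i =? j); cbn [negb Nat.eqb]; [now rewrite andb_false_r|now rewrite andb_true_r]. }
  clearbody s8. set (s9 := run init_span s8).
  assert (R9 : rows n s9) by (unfold rows, s9; now rewrite run_ar by reflexivity).
  assert (A90 : ar s9 0 = ar s4 0) by (unfold s9; now rewrite run_ar by reflexivity).
  assert (A92 : ar s9 2 = ar s6 2) by (unfold s9; now rewrite run_ar by reflexivity).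
  assert (A94 : ar s9 4 = ar s8 4) by (unfold s9; now rewrite run_ar by reflexivity).
  assert (H9 : forall i j, i < n -> j < n -> bm n (ar s9 3) i j = false).
  { intros i j Hi Hj. unfold bm, s9. now rewrite init_span_ok. }
  clearbody s9.
  assert (I9 : is_input n E s9) by (unfold is_input; now rewrite A90).
  assert (D9 : forall i j, i < n -> j < n -> cell n (ar s9 2) i j = if i =? j then 0 else k + 1)
    by (intros; rewrite A92; auto).
  assert (M9 : forall i j, i < n -> j < n -> bm n (ar s9 4) i j = E i j && negb (i =? j))
    by (intros; rewrite A94; auto).
  unfold greedy_inv, rows, is_input.
  rewrite !(run_ar NREGS n k distances 0), !(run_ar NREGS n k distances 1),
    !(run_ar NREGS n k distances 3), !(run_ar NREGS n k distances 4) by reflexivity.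
  split.
  - split; [exact R9|]. split; [exact I9|]. split; [now apply distances_ok|]. split; [|split].
    + intros i j Hi Hj. rewrite M9, andb_true_iff, negb_true_iff, Nat.eqb_neq by auto. auto.
    + intros i j Hi Hj Hb. rewrite H9 in Hb by assumption. discriminate Hb.
    + intros u v Hu Hv He Hne. left. rewrite M9, He by auto. apply Nat.eqb_neq in Hne. now rewrite Hne.
  - apply Nat.le_0_r. apply (num_edges_incl n _ []). intros i j Hi Hj Hb. rewrite H9 in Hb by assumption. discriminate Hb.
Qed.

Lemma prog_init_ok s : vr s 0 = bits_val enc 2 (NREGS - 2) ->
  (forall y, NREGS <= y < base NREGS n -> rw s y = enc y) ->
  greedy_inv n k E (run prog_init s) /\ num_edges n (bm n (ar (run prog_init s) 3)) = 0.
Proof.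
  intros HV HW. unfold prog_init. rewrite !run_seq.
  destruct (unpack_prog_ok s HV) as [HU1 HU2]. rewrite <- HU1 in HW.
  destruct (read_ok _ HU2 HW) as [HR HI]. now apply init_ok.
Qed.

Definition rounds (s : st) (t : nat) : st := iter_for NREGS n k 4 greedy_step s t.

Lemma rounds_S s t : 0 < n -> greedy_inv n k E (rounds s t) ->
  greedy_inv n k E (rounds s (S t)) /\
  exists g, (forall w, w < n -> gain n k (rounds s t) w <= g) /\
    ((g < 2 * n /\ num_edges n (bm n (ar (rounds s (S t)) 4)) = num_edges n (bm n (ar (rounds s t) 4)) /\
       num_edges n (bm n (ar (rounds s (S t)) 3)) = num_edges n (bm n (ar (rounds s t) 3))) \/
     (2 * n <= g /\ num_edges n (bm n (ar (rounds s (S t)) 4)) + g = num_edges n (bm n (ar (rounds s t) 4)) /\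
       num_edges n (bm n (ar (rounds s (S t)) 3)) <= num_edges n (bm n (ar (rounds s t) 3)) + 2 * n)).
Proof.
  intros Hn HI. unfold rounds. rewrite iter_for_S. fold (rounds s t).
  exact (greedy_step_ok n k E (setv (rounds s t) 4 t) HI Hn).
Qed.

Lemma rounds_inv s t : 0 < n -> greedy_inv n k E s -> greedy_inv n k E (rounds s t).
Proof. intros Hn HI. induction t as [|t IH]; [exact HI|]. now apply rounds_S. Qed.

Lemma prog_ok s : 2 < k -> vr s 0 = bits_val enc 2 (NREGS - 2) ->
  (forall y, NREGS <= y < base NREGS n -> rw s y = enc y) ->
  let H0 := bm n (ar (run prog s) 3) in
  (forall y, NREGS <= 2 + y -> y < n * n -> rw (run prog s) (2 + y) = ar (run prog s) 3 y) /\
  is_spanner n k E H0 /\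
  forall H, is_spanner n k E H -> (INR (num_edges n H0) <= 11 * ratio n k * INR (num_edges n H))%R.
Proof.
  intros Hk HV HW. cbv zeta. unfold prog. rewrite !run_seq.
  destruct (prog_init_ok s HV HW) as [HI HN]. set (s1 := run prog_init s) in *.
  change (run greedy s1) with (rounds s1 n). set (s2 := rounds s1 n).
  destruct (Nat.eq_dec n 0) as [Hn0|Hn0].
  { split; [nia|]. split; [split; intros; lia|]. intros H _.
    replace (num_edges n _) with 0 by (now rewrite Hn0). cbn [INR].
    pose proof (ratio_pos n k). pose proof (pos_INR (num_edges n H)). nra. }
  assert (I2 : greedy_inv n k E s2) by (apply rounds_inv; auto; lia).
  destruct I2 as (Hrow & Hin & HD & HR & HS & Hcov).
  assert (Hrow3 : rows n (run finish s2)) by (unfold rows; now rewrite run_ar by reflexivity).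
  assert (A3 : ar (run write_output (run finish s2)) 3 = ar (run finish s2) 3) by (now rewrite run_ar by reflexivity).
  rewrite A3.
  assert (HF : forall i j, i < n -> j < n ->
     bm n (ar (run finish s2) 3) i j = bm n (ar s2 3) i j || bm n (ar s2 4) i j)
    by (intros; now apply finish_ok).
  set (Hf := bm n (ar (run finish s2) 3)) in *.
  split; [now apply write_output_ok|]. split; [split|].
  - intros i j Hi Hj. rewrite HF, orb_true_iff by auto. intros [Hb|Hb]; [auto|now apply HR].
  (* Loops of [E] were never among the remaining edges; the empty walk spans them. *)
  - intros u v Hu Hv He. destruct (Nat.eq_dec u v) as [->|Hne]; [apply reach_refl|].
    destruct (Hcov u v Hu Hv He Hne) as [Hr|Hr].
    + apply reach_mono with 1; [lia|]. apply reach_edge; auto. rewrite HF, Hr by auto. apply orb_true_r.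
    + apply reach_sub with (H := bm n (ar s2 3)); auto.
      intros i j Hi Hj Hb. rewrite HF, Hb by auto. reflexivity.
  - intros H HH.
    pose proof (greedy_ratio n k E H (cell n (ar s1 2)) (fun t => bm n (ar (rounds s1 t) 4))
      (fun t => num_edges n (bm n (ar (rounds s1 t) 3)))) as G. cbv beta in G.
    eapply Rle_trans; [|apply G; auto; try lia].
    + apply le_INR. rewrite (num_edges_ext n Hf _ HF). apply num_edges_orb.
    + apply HI.
    + intros t i j _. apply rounds_inv; auto. lia.
    + intros t Ht. destruct (rounds_S s1 t) as [_ (g & Hg & Hc)]; [lia|apply rounds_inv; auto; lia|].
      exists g. split; [|exact Hc]. intros w Hw. specialize (Hg w Hw). unfold gain in Hg.
      (* No round writes array 2, so every gain refers to the same distances, as [greedy_ratio]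
         requires. *)
      replace (ar (rounds s1 t) 2) with (ar s1 2) in Hg; [exact Hg|].
      clear. induction t as [|t IH]; [reflexivity|].
      unfold rounds. rewrite iter_for_S, run_ar by reflexivity. exact IH.
Qed.

End Final.

Lemma wfc_unpack r : forall i, 3 <= NREGS -> wfc NVARS NARRS (unpack i r) 16 = true.
Proof.
  induction r as [|r IH]; intros i H; [reflexivity|].
  cbn [unpack wfc]. rewrite (IH (S i) H). reflexivity.
Qed.

Lemma wfc_prog : wfc NVARS NARRS prog (NREGS - (5 + NVARS)) = true.
Proof.
  change (NREGS - (5 + NVARS)) with 16. unfold prog, prog_init. cbn [wfc].
  rewrite wfc_unpack by (unfold NREGS; lia). reflexivity.
Qed.

Theorem mainTheorem3 :
  exists (P : program) (c d : nat) (C : R),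
    forall (n k : nat) (E : nat -> nat -> bool),
      2 < k ->
      exists (T : nat) (mout : nat -> nat),
        T <= c * (n + Nat.log2 k + 2) ^ d /\
        exec P T 0 (encode_input n k E) = Some mout /\
        is_spanner n k E (decode_output n mout) /\
        (forall H : nat -> nat -> bool, is_spanner n k E H ->
           (INR (num_edges n (decode_output n mout))
            <= C * ratio n k * INR (num_edges n H))%R).
Proof.
  destruct (cost_poly NREGS NARRS prog (5 + NVARS)) as (a & d & Hcost).
  set (c0 := length (pack NREGS) + 7 + 3 + 2 * (NREGS - 2) + 1).
  (* Array 3 holds the spanner. The 4 and the successor of [d] absorb the [4 n] steps that compute
     the array base; the time bound depends on [n] alone. *)
  exists (whole NREGS NVARS NARRS prog 3), (c0 + 4 + a), (S d), 11%R.
  intros n k E Hk.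
  destruct (whole_ok NREGS NVARS NARRS prog 3 n k E)
    as (s & mout & t & Ht & Hexec & HV & HW & Hlo & Hhi);
    [unfold NREGS, NVARS; lia|unfold NREGS; lia|unfold NVARS; lia|unfold NARRS; lia|apply wfc_prog|].
  destruct (prog_ok n k E s Hk HV HW) as (Hout & Hsp & Hopt).
  assert (Hdec : forall i j, i < n -> j < n ->
     decode_output n mout i j = bm n (ar (run_cmd NREGS n k prog s) 3) i j).
  { intros i j Hi Hj. unfold decode_output, bm, cell. f_equal. f_equal. rewrite <- Nat.add_assoc.
    assert (i * n + j < n * n) by nia.
    (* Entries below [NREGS - 2] lie in register cells and come from the epilogue, the others from
       [write_output]. *)
    destruct (Nat.lt_ge_cases (i * n + j) (NREGS - 2)).
    - now apply Hlo.
    - rewrite Hhi; [apply Hout; lia|]. unfold base. lia. }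
  exists t, mout. split; [|split; [exact Hexec|split]].
  - specialize (Hcost n).
    assert (H1 : (n + 2) ^ S d <= (n + Nat.log2 k + 2) ^ S d) by (apply Nat.pow_le_mono_l; lia).
    assert (H2 : 1 <= (n + 2) ^ d) by (apply Nat.neq_0_lt_0, Nat.pow_nonzero; lia).
    eapply Nat.le_trans; [exact Ht|]. eapply Nat.le_trans; [|apply Nat.mul_le_mono_l; exact H1].
    rewrite Nat.pow_succ_r'.
    replace (length (pack NREGS) + 7 + 4 * n + cost NREGS NARRS n (5 + NVARS) prog + 3 + 2 * (NREGS - 2) + 1)
      with (c0 + 4 * n + cost NREGS NARRS n (5 + NVARS) prog) by (unfold c0; lia).
    generalize dependent (cost NREGS NARRS n (5 + NVARS) prog). intros q Hq. generalize c0. intros c1 _. nia.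
  - destruct Hsp as [S1 S2]. split.
    + intros i j Hi Hj. rewrite Hdec by auto. auto.
    + intros u v Hu Hv He. apply reach_sub with (H := bm n (ar (run_cmd NREGS n k prog s) 3)); auto.
      intros i j Hi Hj. now rewrite Hdec.
  - intros H HH. rewrite (num_edges_ext n _ _ Hdec). auto.
Qed.
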